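(* Let $\beta\ge 0$, and consider the ferromagnetic Ising model on the two-slab graph with vertex set $\mathbb{Z}^2\times\{0,1\}$ at inverse temperature $\beta$, with zero external field and interaction $1$ on every edge. Let $\mu_+,\mu_-$ be its Gibbs measures with plus and minus boundary conditions. Then, for each choice of sign $\pm$, $$|M(\mu_{\pm})|\le R(\mathbf{c}^{\pm};\mu_{\pm}).$$ Moreover, $R(\mathbf{c}^{\pm};\mu_{\pm})>0$ if and only if $|M(\mu_{\pm})|>0$.
   Context: The two-slab graph has vertex set $\mathbb{Z}^2\times\{0,1\}$ and an edge between every two vertices at Euclidean distance one. Let $\Sigma^{(2)}=\{-1,+1\}^{\mathbb{Z}^2\times\{0,1\}}$ with the $\sigma$-field generated by finite-dimensional cylinders. The measure $\mu_\pm$ on $\Sigma^{(2)}$ is the weak limit, as the finite box $B\uparrow\mathbb{Z}^2$, of the finite-volume Ising measures on $\Lambda=B\times\{0,1\}$ with all spins outside $\Lambda$ (in the two-slab graph) equal to $\pm1$ and weights proportional to $\exp\{\beta\sum_{\langle x,y\rangle}\sigma_x\sigma_y\}$, the sum being over edges of the graph with at least one endpoint in $\Lambda$. Magnetization at the origin: $M(\mu_\pm)=\mathbb{E}_{\mu_\pm}(\sigma_{0,0,0})$. A $2$-vertex is a column $\mathbf{c}_{i,j}=((i,j,0),(i,j,1))$ with $(i,j)\in\mathbb{Z}^2$. Two $2$-vertices $\mathbf{c}_{i,j},\mathbf{c}_{l,m}$ are adjacent when $(i,j)$ and $(l,m)$ are adjacent in $\mathbb{Z}^2$. For $\sigma\in\Sigma^{(2)}$,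 a $(\mathbf{c}^+)$-cluster (respectively $(\mathbf{c}^-)$-cluster) of $\sigma$ is a maximal connected set of $2$-vertices $\mathbf{c}_{i,j}$ such that $\sigma_{i,j,0}+\sigma_{i,j,1}>0$ (respectively $<0$). The percolation probability is $$R(\mathbf{c}^\pm;\mu_\pm)=\mu_\pm(\{\sigma:\mathbf{c}_{0,0}\text{ belongs to an infinite }(\mathbf{c}^\pm)\text{-cluster of }\sigma\}),$$ with the same sign taken throughout. *)

(* Defs.v *)
From HB Require Import structures.
From mathcomp Require Import all_boot all_order all_algebra finmap zify ring.
From mathcomp Require Import all_classical all_reals all_analysis.

Set Implicit Arguments.
Unset Strict Implicit.
Unset Printing Implicit Defensive.

Import Order.TTheory GRing.Theory Num.Theory.
Import numFieldNormedType.Exports.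

Local Open Scope classical_set_scope.
Local Open Scope ring_scope.

Notation Z2 := (int * int)%type.
Notation slab := (Z2 * 'I_2)%type.
Notation config := (slab -> bool).

(* Two points are adjacent when their squared Euclidean distance is 1. *)
Definition dist2 (c d : Z2) : int := (c.1 - d.1) ^+ 2 + (c.2 - d.2) ^+ 2.

Definition adj_Z2 (c d : Z2) : bool := dist2 c d == 1.

Definition adj_slab (x y : slab) : bool :=
  dist2 x.1 y.1 + (x.2%:Z - y.2%:Z) ^+ 2 == 1.

(* Spins and signs are booleans: true is +1 and false is -1. *)
Definition spin {K : pzRingType} (b : bool) : K := if b then 1 else -1.

Definition cylinders : set (set config) :=
  [set A | exists (L : {fset slab}) (eta : config),
     A = [set sigma : config | forall x, x \in L -> sigma x = eta x]].

Definition Sigma2 := g_sigma_algebraType cylinders.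
HB.instance Definition _ := Measurable.on Sigma2.

Section finite_volume.
Context {R : realType}.
Variables (beta : R) (s : bool) (L : {fset slab}).

Definition extend (tau : {ffun L -> bool}) : Sigma2 :=
  fun x => oapp tau s (insub x).

(* Unordered edges with at least one endpoint in L. *)
Definition edges_touching : set {fset slab} :=
  [set e | exists x y : slab,
     [/\ e = [fset x; y]%fset, adj_slab x y & (x \in L) || (y \in L)]].

Definition interaction (sigma : config) : R :=
  \sum_(e \in edges_touching) \prod_(x <- e) (spin (sigma x) : R).

Definition weight (tau : {ffun L -> bool}) : R :=
  expR (beta * interaction (extend tau)).

Definition partition_function : R := \sum_(tau : {ffun L -> bool}) weight tau.

Definition ising : set Sigma2 -> \bar R := fun A =>
  (\sum_(tau : {ffun L -> bool})
     (weight tau / partition_function)%:E * \d_(extend tau) A)%E.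

Lemma weight_gt0 tau : 0 < weight tau.
Proof. exact: expR_gt0. Qed.

Lemma partition_function_gt0 : 0 < partition_function.
Proof.
rewrite /partition_function (bigD1 [ffun=> true]) //=.
by rewrite ltr_pwDl ?weight_gt0// sumr_ge0// => tau _; exact/ltW/weight_gt0.
Qed.

Let prob_ge0 tau : 0 <= weight tau / partition_function.
Proof.
by rewrite divr_ge0// ltW// ?weight_gt0 ?partition_function_gt0.
Qed.

Let ising0 : ising set0 = 0%E.
Proof. by rewrite /ising big1// => tau _; rewrite measure0 mule0. Qed.

Let ising_ge0 A : (0 <= ising A)%E.
Proof.
by rewrite /ising sume_ge0// => tau _; rewrite mule_ge0// lee_fin.
Qed.

Let isingE (tau0 : {ffun L -> bool}) : ising =
  msum (fun k => mscale (NngNum (prob_ge0 (nth tau0 (enum {ffun L -> bool}) k)))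
    (dirac (extend (nth tau0 (enum {ffun L -> bool}) k))))
  (size (enum {ffun L -> bool})).
Proof.
apply/funext => A; rewrite /ising /msum /mscale/= -big_enum (big_nth tau0) /=.
by rewrite big_mkord.
Qed.

Let ising_sigma_additive : semi_sigma_additive ising.
Proof.
rewrite (isingE [ffun=> true]); exact: measure_semi_sigma_additive.
Qed.

HB.instance Definition _ := isMeasure.Build _ Sigma2 R ising
  ising0 ising_ge0 ising_sigma_additive.

Let ising_setT : ising [set: Sigma2] = 1%E.
Proof.
rewrite /ising.
under eq_bigr do rewrite diracT mule1.
rewrite sumEFin -mulr_suml divff//; exact/lt0r_neq0/partition_function_gt0.
Qed.

HB.instance Definition _ :=
  Measure_isProbability.Build _ Sigma2 R ising ising_setT.

End finite_volume.

(* Hence the sum in interaction, a big operator over a set, is a true sum. *)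
Lemma finite_edges_touching (L : {fset slab}) : finite_set (edges_touching L).
Proof.
pose offsets : {fset int} := [fset -1; 0; 1]%fset.
have sq1 (m : int) : m ^+ 2 <= 1 -> m \in offsets.
  rewrite -real_normK ?num_real// expr_le1// ler_norml => m1.
  by rewrite !inE; lia.
pose nbr (q : slab * slab) : slab :=
  ((q.1.1.1 + q.2.1.1, q.1.1.2 + q.2.1.2), q.2.2).
pose D : {fset slab * slab} :=
  (L `*` ((offsets `*` offsets) `*` [fset k | k in 'I_2]))%fset.
have key x y : x \in L -> adj_slab x y -> exists2 q, q \in D & [fset x; y]%fset = [fset q.1; nbr q]%fset.
  case: x y => [[x1 x2] k] [[y1 y2] l] xL; rewrite /adj_slab /dist2 /= => /eqP xy.
  exists (((x1, x2), k), ((y1 - x1, y2 - x2), l)); last by rewrite /nbr/= !subrKC.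
  rewrite !in_fsetM/= xL/= !sq1 ?in_imfset//=.
    have := sqr_ge0 (x1 - y1); have := sqr_ge0 (k%:Z - l%:Z).
    rewrite -(sqrrN (y2 - x2)) opprB; lia.
  have := sqr_ge0 (x2 - y2); have := sqr_ge0 (k%:Z - l%:Z).
  rewrite -(sqrrN (y1 - x1)) opprB; lia.
apply: (@sub_finite_set _ _ ((fun q => [fset q.1; nbr q]%fset) @` [set` D])); last first.
  exact/finite_image/finite_fset.
move=> e [x [y [-> xy /orP[xL|yL]]]].
  by have [q qD ->] := key _ _ xL xy; exists q.
have yx : adj_slab y x.
  by move: xy; rewrite /adj_slab /dist2 => /eqP <-; apply/eqP; ring.
by have [q qD] := key _ _ yL yx; rewrite fsetUC => ->; exists q.
Qed.

Definition is_box (B : {fset Z2}) : Prop :=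
  exists a b c d : int, forall i j : int,
    ((i, j) \in B) = (a <= i <= b) && (c <= j <= d).

(* The filter of B tending to Z^2 along finite boxes. *)
Definition boxes : set_system {fset Z2} :=
  filter_from [set: {fset Z2}]
    (fun B0 => [set B : {fset Z2} | is_box B /\ (B0 `<=` B)%fset]).

#[global] Instance boxes_filter : ProperFilter boxes.
Proof.
apply: filter_from_proper.
  apply: filter_from_filter; first by exists fset0.
  move=> B1 B2 _ _; exists (B1 `|` B2)%fset => // B [boxB].
  by rewrite fsubUset => /andP[].
move=> B0 _; pose N := (\sum_(c <- B0) (`|c.1| + `|c.2|))%N.
pose I := 'I_(N + N).+1.
pose corner (q : I * I) : Z2 := (q.1%:Z - N%:Z, q.2%:Z - N%:Z).
pose B := [fset corner q | q in {: I * I}]%fset.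
exists B.
have mem (i j : int) :
    ((i, j) \in B) = (- N%:Z <= i <= N%:Z) && (- N%:Z <= j <= N%:Z).
  apply/imfsetP/idP => [[[k l] _ [-> ->]]/=|ij].
    have := ltn_ord k; have := ltn_ord l; lia.
  have iN : (`|(i + N%:Z)%R| < (N + N).+1)%N by lia.
  have jN : (`|(j + N%:Z)%R| < (N + N).+1)%N by lia.
  exists (Ordinal iN, Ordinal jN) => //=.
  by rewrite /corner/=; congr pair; lia.
split; first by exists (- N%:Z), N%:Z, (- N%:Z), N%:Z.
apply/fsubsetP => -[i j] ijB0; rewrite mem.
have : (`|i| + `|j| <= N)%N by rewrite /N (big_fsetD1 (i, j))//= leq_addr.
lia.
Qed.

Definition slab_over (B : {fset Z2}) : {fset slab} :=
  (B `*` [fset k | k in 'I_2])%fset.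

Section infinite_volume.
Context {R : realType}.

(* mu is the weak limit of the finite-volume measures with boundary condition s;
   weak convergence is tested on bounded functions that are continuous for the
   product of the discrete topologies. *)
Definition is_ising_limit (beta : R) (s : bool) (mu : probability Sigma2 R) :=
  forall f : Sigma2 -> R,
    continuous (f : prod_topology (fun _ : slab => bool) -> R) ->
    (exists M : R, forall sigma, `|f sigma| <= M) ->
    (\int[ising beta s (slab_over B)]_sigma (f sigma)%:E)%E @[B --> boxes]
      --> (\int[mu]_sigma (f sigma)%:E)%E.

Definition origin : Z2 := (0, 0).

Definition magnetization (mu : probability Sigma2 R) : \bar R :=
  ('E_mu[fun sigma : Sigma2 => spin (sigma (origin, ord0))])%E.

(* A 2-vertex is identified with its base point in Z^2. *)
Definition column_sum (sigma : config) (c : Z2) : int :=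
  spin (sigma (c, ord0)) + spin (sigma (c, ord_max)).

Definition signed_columns (s : bool) (sigma : config) : set Z2 :=
  [set c | if s then 0 < column_sum sigma c else column_sum sigma c < 0].

Definition connected_Z2 (C : set Z2) : Prop :=
  forall c d, C c -> C d ->
    exists p : seq Z2,
      [/\ path adj_Z2 c p, last c p = d & forall e, e \in p -> C e].

Definition is_cluster (s : bool) (sigma : config) (C : set Z2) : Prop :=
  [/\ C `<=` signed_columns s sigma, connected_Z2 C &
      forall D : set Z2, C `<=` D -> D `<=` signed_columns s sigma ->
        connected_Z2 D -> D = C].

Definition percolation (s : bool) (mu : probability Sigma2 R) : \bar R :=
  mu [set sigma : Sigma2 | exists C : set Z2,
        [/\ is_cluster s sigma C, C origin & infinite_set C]].

End infinite_volume.

(* Main.v *)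
Require Import Defs.
From HB Require Import structures.
From mathcomp Require Import all_boot all_order all_algebra finmap zify ring lra.
From mathcomp Require Import all_classical all_reals all_analysis.

Set Implicit Arguments.
Unset Strict Implicit.
Unset Printing Implicit Defensive.

Import Order.TTheory GRing.Theory Num.Theory.
Import numFieldNormedType.Exports.

Local Open Scope classical_set_scope.
Local Open Scope ring_scope.

(** Flipping all spins turns minus into plus boundary conditions, so let the sign
be plus. Every quantity of the theorem is a limit of probabilities of local
events, and for those the weak limit gives [P A], the limit over boxes of the
finite-volume probabilities [fv]. Besides the symmetries of the lattice, which
hold because they map boxes to boxes, [P] inherits from finite volume the FKG
inequality, finite energy and the Markov property. FKG and monotonicity in the
boundary condition both come from the four functions theorem.

Magnetization is at most percolation. In a box, reveal the cluster of [++]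
columns attached to the boundary. The columns next to it are not [++]. Flipping
all spins and exchanging the two layers fixes the columns [+-] and [-+] and
raises [--], so under such a boundary condition the unrevealed spins have
nonpositive mean ([gibbs_nonplus_bc]). Only a column that is connected to the
boundary can contribute ([gibbs_magnetization_le]).

Percolation forces magnetization. Suppose that the magnetization vanishes but the
origin escapes to infinity with positive probability. Plus and minus boundary
conditions then have the same limit ([fv_false_lim]), which is therefore
invariant under the flip and mixing. By mixing, a large square is joined to
infinity with probability near 1 ([has_arm_whp]). FKG and the eight symmetries
turn this into an arm from each of the eight half sides, of either sign
([arm_whp]). So three [++] arms and three [--] arms that alternate around the
square exist with probability at least 1/2. By planarity the [--] arms keep the
[++] arms apart outside the square ([core_adjacent_sides]), and if finite energy
fills the square with [+] spins, the square is a trifurcation of the [++]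
columns. Its translates are trifurcations with the same probability, so their
expected number in a box is of the order of the area. As in the argument of
Burton and Keane, disjoint trifurcations are at most as numerous as the boundary
columns ([size_trifurcations]), a contradiction for a large box ([esc_vanish]). *)

(** * Connections inside a set of vertices *)

Section connections.
Variables (T : eqType) (e : rel T).
Implicit Types (U V : T -> bool) (x y z : T).

Definition conn U x y : Prop :=
  exists p : seq T, [/\ path e x p, last x p = y & all U (x :: p)].

Lemma conn_refl U x : U x -> conn U x x.
Proof. by move=> Ux; exists [::]; split => //=; rewrite Ux. Qed.

Lemma conn_endl U x y : conn U x y -> U x.
Proof. by case=> p [_ _ /= /andP[]]. Qed.

Lemma conn_endr U x y : conn U x y -> U y.
Proof. by case=> p [_ <- /allP]; apply; exact: mem_last. Qed.

Lemma conn_trans U x y z : conn U x y -> conn U y z -> conn U x z.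
Proof.
move=> [p [ep <- Up]] [q [eq <- Uq]]; exists (p ++ q); split.
- by rewrite cat_path ep.
- by rewrite last_cat.
- by rewrite -cat_cons all_cat Up; case/andP: Uq.
Qed.

Lemma conn_adj U x y : e x y -> U x -> U y -> conn U x y.
Proof. by move=> exy Ux Uy; exists [:: y]; split; rewrite /= ?exy ?Ux ?Uy. Qed.

Lemma conn_sub U V x y : (forall z, U z -> V z) -> conn U x y -> conn V x y.
Proof.
by move=> UV [p [ep lp Up]]; exists p; split => //; apply: sub_all Up.
Qed.

Lemma conn_ind U x (Q : T -> Prop) y : conn U x y -> (U x -> Q x) ->
  (forall y z, conn U x y -> Q y -> e y z -> U z -> Q z) -> Q y.
Proof.
move=> [p [ep <- /= /andP[Ux Up]]] Qx Qs.
elim/last_ind: p ep Up => [_ _|p z IH]; first exact: Qx.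
rewrite rcons_path all_rcons last_rcons => /andP[ep ez] /andP[Uz Up].
apply: Qs ez Uz; last exact: IH.
by exists p; split => //=; rewrite Ux.
Qed.

(** All cutting of paths below is done through the first exit from a set. *)
Lemma conn_exit U V x y : conn U x y -> V x -> ~~ V y ->
  exists a b, [/\ conn (predI U V) x a, e a b, U b & ~~ V b].
Proof.
move=> xy Vx nVy.
suff [//|Vy]: (exists a b, [/\ conn (predI U V) x a, e a b, U b & ~~ V b])
    \/ conn (predI U V) x y.
  by have /andP[_ Vy'] := conn_endr Vy; rewrite Vy' in nVy.
pattern y; apply: (conn_ind xy) => [Ux|{nVy}y' z xy' IH eyz Uz].
  by right; apply: conn_refl; rewrite /= Ux.
case: IH => [|xVy]; first by left.
have [Vz|nVz] := boolP (V z); last by left; exists y', z; split.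
right; apply: (conn_trans xVy).
by apply: conn_adj => //=; [exact: conn_endr xVy|rewrite Uz].
Qed.

Hypothesis esym : symmetric e.

Lemma conn_sym U x y : conn U x y -> conn U y x.
Proof.
move=> xy; have Ux := conn_endl xy.
pattern y; apply: (conn_ind xy) => [_|{xy}y' z xy yx eyz Uz]; first exact: conn_refl.
apply: conn_trans yx; apply: conn_adj => //; [by rewrite esym|exact: conn_endr xy].
Qed.

End connections.

(** * Counting trifurcations *)

Section trifurcations.
Variables (T : choiceType) (e : rel T).
Hypothesis esym : symmetric e.
Implicit Types (U Y t : {fset T}) (x y z : T).

Definition fconn U x y := conn e (fun z => z \in U) x y.

Definition branch U Y t x :=
  [/\ x \in Y, x \in (U `\` t)%fset & forall v, v \in t -> fconn U x v].

(** The encounter points of Burton and Keane, with a set [t] in the role of the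
point; the ends of the branches are kept in [Y], where they are counted. *)
Definition trifurcation U Y t := exists a : 'I_3 -> T,
  (forall i, branch U Y t (a i)) /\
  (forall i j, i != j -> ~ fconn (U `\` t)%fset (a i) (a j)).

Definition component U x : {fset T} := [fset v in U | `[< fconn U x v >]]%fset.

Lemma componentP U x v : reflect (fconn U x v) (v \in component U x).
Proof.
apply: (iffP idP); first by rewrite !inE => /andP[_ /asboolP].
by move=> xv; rewrite !inE (conn_endr xv); exact/asboolP.
Qed.

Lemma fconn_sub U Y x y : (U `<=` Y)%fset -> fconn U x y -> fconn Y x y.
Proof. by move=> /fsubsetP UY; apply: conn_sub. Qed.

Lemma proper_card U Y : (forall x, x \in U -> x \in Y) ->
  (exists2 x, x \in Y & x \notin U) -> (#|` U| < #|` Y|)%N.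
Proof.
move=> UY [x xY xU]; apply: fproper_ltn_card; rewrite fproperE.
by apply/andP; split; [exact/fsubsetP|apply/fsubsetPn; exists x].
Qed.

(** A component of [U `\` t] is attached to the rest of [U] through [t] only,
so it can be deleted without disconnecting anything else. *)
Lemma fconn_delete U t a x y :
  (forall v w, v \in t -> w \in t -> fconn t v w) -> (t `<=` U)%fset ->
  let C := component (U `\` t)%fset a in
  x \notin C -> y \notin C -> fconn U x y -> fconn (U `\` C)%fset x y.
Proof.
move=> tconn tU C xC yC xy.
have tU' : (t `<=` U `\` C)%fset.
  apply/fsubsetP => v vt; rewrite inE (fsubsetP tU _ vt) andbT.
  by apply/negP => /componentP/conn_endr; rewrite inE vt.
have tconn' v w : v \in t -> w \in t -> fconn (U `\` C)%fset v w.
  by move=> vt wt; apply: fconn_sub tU' (tconn _ _ vt wt).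
have attach v w : e v w -> v \in U -> v \notin C -> w \in C -> v \in t.
  move=> evw vU vC wC; apply: contraNT vC => vt; apply/componentP.
  apply: (conn_trans (componentP _ _ _ wC)); apply: conn_adj; first by rewrite esym.
    exact: conn_endr (componentP _ _ _ wC).
  by rewrite inE vt.
suff: if y \in C then forall v, v \in t -> fconn (U `\` C)%fset x v
      else fconn (U `\` C)%fset x y by rewrite (negbTE yC).
pattern y; apply: (conn_ind xy) => [xU|{yC}v w {}xy IH evw wU].
  by rewrite (negbTE xC); apply: conn_refl; rewrite inE xC xU.
have vU : v \in U := conn_endr xy.
have [wC|wC] := boolP (w \in C); have [vC|vC] := boolP (v \in C);
  rewrite ?vC ?(negbTE vC) in IH => //.
- move=> u ut; apply: (conn_trans IH); apply: tconn' => //.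
  exact: attach evw vU vC wC.
- by apply: IH; apply: (attach w v) => //; rewrite esym.
- apply: (conn_trans IH); apply: conn_adj => //; first exact: conn_endr IH.
  by rewrite inE wC.
Qed.

(** By induction on the number of tiles. Some tile has a branch that contains no
other tile; delete the branch, which has an end in [Y] of its own, and forget
that tile. The other tiles still trifurcate: a branch from one of them that
ended in the deleted part can be redirected to another branch of the forgotten
tile. *)
Lemma size_trifurcations (ts : seq {fset T}) U Y : uniq ts ->
  (forall t, t \in ts -> t != fset0 /\ (t `<=` U)%fset) ->
  (forall t v w, t \in ts -> v \in t -> w \in t -> fconn t v w) ->
  (forall t t', t \in ts -> t' \in ts -> t != t' -> [disjoint t & t']%fset) ->
  (forall t, t \in ts -> trifurcation U Y t) ->
  (size ts <= #|` (Y `&` U)%fset|)%N.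
Proof.
move: {2}(size ts) (erefl (size ts)) => k.
elim: k ts U => [|k IH] ts U szts uts tsU tconn tdisj tri; first by rewrite szts.
pose Q m := `[< exists t a, [/\ t \in ts, branch U Y t a &
  #|` component (U `\` t)%fset a| = m]>].
have exQ : exists m, Q m.
  case: ts szts uts tsU tconn tdisj tri @Q => // t ts _ _ _ _ _ tri.
  have [a [ba _]] := tri t (mem_head _ _).
  exists #|` component (U `\` t)%fset (a ord0)|; apply/asboolP.
  by exists t, (a ord0); split => //; exact: mem_head.
case: (ex_minnP exQ) => m /asboolP[t [a [tts bra Cm]]] minm.
set C := component (U `\` t)%fset a in Cm.
have [aY aUt at_] := bra.
have [/fset0Pn[v0 v0t] tU] := tsU t tts.
have Ct v : v \in C -> v \notin t.
  by move=> /componentP/conn_endr; rewrite inE => /andP[].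
have CU v : v \in C -> v \in U.
  by move=> /componentP/conn_endr; rewrite inE => /andP[].
have disjN t1 t2 v : t1 \in ts -> t2 \in ts -> t1 != t2 -> v \in t1 -> v \notin t2.
  by move=> t1s t2s t12 vt1; exact: (fdisjointP (tdisj _ _ t1s t2s t12)).
have tileUt t1 t2 : t1 \in ts -> t2 \in ts -> t1 != t2 -> (t1 `<=` U `\` t2)%fset.
  move=> t1s t2s t12; apply/fsubsetP => v vt; rewrite inE.
  by rewrite (disjN t1 t2)// (fsubsetP (tsU _ t1s).2).
(* A tile in C would have a branch away from t, hence inside C and smaller. *)
have Cfree t' : t' \in ts -> t' != t -> forall v, v \in t' -> v \notin C.
  move=> t's t't v vt'; apply/negP => vC.
  have [a' [bra' sep']] := tri t' t's.
  have tt' : t != t' by rewrite eq_sym.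
  have [i ni] : exists i, ~ fconn (U `\` t')%fset (a' i) v0.
    apply: contrapT => /forallNP H.
    have H' i : fconn (U `\` t')%fset (a' i) v0 by apply: contrapT; exact: H.
    apply: (sep' ord0 ord_max) => //.
    exact: conn_trans (H' _) (conn_sym esym (H' _)).
  set C' := component (U `\` t')%fset (a' i).
  have [aY' aU' at'] := bra' i.
  have C't w : w \in C' -> w \notin t.
    move=> /componentP aw; apply/negP => wt; apply: ni; apply: (conn_trans aw).
    exact: fconn_sub (tileUt _ _ tts t's tt') (tconn _ _ _ tts wt v0t).
  have C'sub w : w \in C' -> fconn (U `\` t)%fset (a' i) w.
    move=> /componentP aw; pattern w; apply: (conn_ind aw) => [_|x y ax IHx exy yU].
      apply: conn_refl; rewrite inE; have := aU'; rewrite inE => /andP[_ ->].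
      by rewrite andbT; apply: C't; apply/componentP; exact: conn_refl.
    apply: (conn_trans IHx); apply: conn_adj => //; first exact: conn_endr IHx.
    move: (yU); rewrite !inE => /andP[_ ->]; rewrite andbT; apply: C't.
    apply/componentP; apply: (conn_trans ax); apply: conn_adj => //.
    exact: conn_endr ax.
  have a'C : fconn (U `\` t)%fset (a' i) v.
    have [|||x [y [ax exy yU yt]]] := @conn_exit _ e (fun z => z \in U)
        (fun z => z \notin t') (a' i) v.
    - exact: at'.
    - by move: aU'; rewrite inE => /andP[].
    - by rewrite negbK.
    rewrite negbK in yt.
    have ax' : x \in C'.
      apply/componentP; apply: conn_sub ax => z /= /andP[zU zt].
      by rewrite inE zt zU.
    apply: (@conn_trans _ _ _ _ y).
      apply: (conn_trans (C'sub _ ax')); apply: conn_adj => //.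
        exact: conn_endr (C'sub _ ax').
      by rewrite inE yU (disjN t' t).
    exact: fconn_sub (tileUt _ _ t's tts t't) (tconn _ _ _ t's yt vt').
  have : (#|` C'| < #|` C|)%N.
    apply: proper_card => [w wC'|].
      apply/componentP; apply: (conn_trans (componentP _ _ _ vC)).
      exact: conn_trans (conn_sym esym a'C) (C'sub _ wC').
    by exists v => //; apply/negP => /componentP/conn_endr; rewrite inE vt'.
  rewrite Cm ltnNge => /negP; apply; apply: minm; apply/asboolP.
  by exists t', (a' i); split.
have aC : a \in C by apply/componentP; exact: conn_refl.
have YU : (#|` (Y `&` (U `\` C))%fset| < #|` (Y `&` U)%fset|)%N.
  apply: proper_card => [w|].
    by rewrite !inE => /and3P[-> _ ->].
  by exists a; rewrite in_fsetI ?in_fsetD ?aC ?aY ?(CU _ aC) ?andbF.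
have szr : size (rem t ts) = k by rewrite size_rem// szts.
have remE t' : t' \in rem t ts -> t' \in ts /\ t' != t.
  by rewrite mem_rem_uniq// inE => /andP[].
rewrite szts; apply: leq_ltn_trans YU; rewrite -szr; apply: IH => //.
- exact: rem_uniq.
- move=> t' /remE[t's t't]; have [t'0 t'U] := tsU _ t's; split=> //.
  by apply/fsubsetP => v vt'; rewrite inE (Cfree t')// (fsubsetP t'U).
- by move=> t' v w /remE[t's _]; exact: tconn.
- by move=> t1 t2 /remE[t1s _] /remE[t2s _]; exact: tdisj.
move=> t' /remE[t's t't]; have [a' [bra' sep']] := tri t' t's.
have tt' : t != t' by rewrite eq_sym.
have [/fset0Pn[v1 v1t'] t'U] := tsU t' t's.
have toU' x y : x \notin C -> y \notin C -> fconn U x y ->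
    fconn (U `\` C)%fset x y.
  by apply: (@fconn_delete U t a) => // v w; exact: tconn.
have subC' : (U `\` C `\` t' `<=` U `\` t')%fset.
  by apply/fsubsetP => w; rewrite !inE => /and3P[-> _ ->].
have Ctot i : a' i \in C -> fconn (U `\` t')%fset (a' i) v0.
  move=> aiC.
  have aia : fconn (U `\` t)%fset (a' i) a := conn_sym esym (componentP _ _ _ aiC).
  have [|||x [y [ax exy yU yt]]] := @conn_exit _ e (fun z => z \in U)
      (fun z => z \notin t) (a' i) v0.
  - apply: (conn_trans _ (at_ _ v0t)); apply: fconn_sub aia.
    by rewrite fsubsetDl.
  - exact: Ct.
  - by rewrite negbK.
  rewrite negbK in yt.
  have inC z : fconn (U `\` t)%fset (a' i) z -> z \in C.
    by move=> aiz; apply/componentP/(conn_trans (componentP _ _ _ aiC)).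
  have ax' : conn e (fun z => z \in (U `\` t')%fset) (a' i) x.
    pattern x; apply: (conn_ind ax) => [aiU|z w az IHz ezw /andP[/= wU wt]].
      apply: conn_refl; move: aiU => /andP[/= aiU ait]; rewrite inE aiU andbT.
      by apply/negP => /(Cfree _ t's t't); rewrite aiC.
    apply: (conn_trans IHz); apply: conn_adj => //; first exact: conn_endr IHz.
    rewrite inE wU andbT; apply/negP => /(Cfree _ t's t't)/negP; apply.
    apply: inC; have az' : fconn (U `\` t)%fset (a' i) z.
      by apply: conn_sub az => u /= /andP[uU ut]; rewrite inE ut uU.
    apply: (conn_trans az'); apply: conn_adj => //; first exact: conn_endr az'.
    by rewrite inE wt wU.
  apply: (conn_trans ax'); apply: (@conn_trans _ _ _ _ y).
    apply: conn_adj => //; first exact: conn_endr ax'.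
    by rewrite inE yU (disjN t t').
  exact: fconn_sub (tileUt _ _ tts t's tt') (tconn _ _ _ tts yt v0t).
(* Of the three branches of t, at most one is C and at most one leads to t'. *)
have [b [brb bC bt']] : exists b, [/\ branch U Y t b, b \notin C &
    ~ fconn (U `\` t)%fset b v1].
  have [b [brb sepb]] := tri t tts.
  have two (P : 'I_3 -> Prop) : (forall i j, i != j -> P i -> P j -> False) ->
      forall R : 'I_3 -> Prop, (forall i j, i != j -> R i -> R j -> False) ->
      exists i, ~ P i /\ ~ R i.
    move=> uP Q' uQ; apply: contrapT => /forallNP H.
    have H' i : P i \/ Q' i.
      by apply: contrapT => /not_orP; exact: H.
    pose i1 : 'I_3 := inord 1.
    have d01 : (ord0 : 'I_3) != i1 by rewrite -val_eqE /= inordK.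
    have d02 : (ord0 : 'I_3) != ord_max by [].
    have d12 : i1 != ord_max by rewrite -val_eqE /= inordK.
    case: (H' ord0) (H' i1) (H' ord_max) => h0 [] h1 [] h2;
      by [exact: (uP _ _ d01)|exact: (uQ _ _ d01)|exact: (uP _ _ d02)|
          exact: (uQ _ _ d02)|exact: (uP _ _ d12)|exact: (uQ _ _ d12)].
  have [||i [niC ni1]] := two (fun i => b i \in C) _
      (fun i => fconn (U `\` t)%fset (b i) v1).
  - move=> i j ij /componentP ai /componentP aj; apply: (sepb i j ij).
    exact: conn_trans (conn_sym esym ai) aj.
  - move=> i j ij bi bj; apply: (sepb i j ij).
    exact: conn_trans bi (conn_sym esym bj).
  by exists (b i); split => //; exact/negP.
have [bY bUt bt] := brb.
have bt'2 : fconn (U `\` C `\` t')%fset b v0.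
  have v0C : v0 \notin C by apply/negP => /Ct; rewrite v0t.
  have [|||x [y [ax exy yU yt]]] := @conn_exit _ e (fun z => z \in U)
      (fun z => z \notin t) b v0.
  - exact: bt.
  - by move: bUt; rewrite inE => /andP[].
  - by rewrite negbK.
  rewrite negbK in yt.
  have bz z : conn e (predI (fun z => z \in U) (fun z => z \notin t)) b z ->
      z \in (U `\` C `\` t')%fset.
    move=> bz; have bz' : fconn (U `\` t)%fset b z.
      by apply: conn_sub bz => u /= /andP[uU ut]; rewrite inE ut uU.
    have /andP[/= zU _] := conn_endr bz; rewrite !in_fsetD zU andbT.
    apply/andP; split; apply/negP.
      move=> zt'; apply: bt'; apply: (conn_trans bz').
      exact: fconn_sub (tileUt _ _ t's tts t't) (tconn _ _ _ t's zt' v1t').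
    move=> /componentP az; move/negP: bC; apply; apply/componentP.
    exact: conn_trans az (conn_sym esym bz').
  have tUC : (t `<=` U `\` C `\` t')%fset.
    apply/fsubsetP => w wt; rewrite !in_fsetD (disjN t t')// (fsubsetP tU)// andbT.
    by apply/negP => /Ct; rewrite wt.
  apply: (@conn_trans _ _ _ _ x).
    pattern x; apply: (conn_ind ax) => [bU|z w az IHz ezw wU].
      by apply: conn_refl; apply: bz; exact: conn_refl.
    apply: (conn_trans IHz); apply: conn_adj => //; first exact: conn_endr IHz.
    apply: bz; apply: (conn_trans az); apply: conn_adj => //.
    exact: conn_endr az.
  apply: (@conn_trans _ _ _ _ y).
    by apply: conn_adj => //; [exact: bz|exact: (fsubsetP tUC)].
  exact: fconn_sub tUC (tconn _ _ _ tts yt v0t).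
pose a2 i := if a' i \in C then b else a' i.
exists a2; split.
  move=> i; rewrite /a2; have [aY' aU' at'] := bra' i.
  case: ifPn => [aiC|aiC]; split => //.
  - by have := conn_endl bt'2.
  - move=> v vt'; apply: toU' => //; first exact: Cfree vt'.
    apply: (@conn_trans _ _ _ _ v0); first exact: bt.
    apply: (@conn_trans _ _ _ _ (a' i)); last exact: at'.
    apply: (conn_sym esym); apply: fconn_sub (Ctot _ aiC).
    by rewrite fsubsetDl.
  - by move: aU'; rewrite !in_fsetD aiC => /andP[-> ->].
  - by move=> v vt'; apply: toU' => //; [exact: Cfree vt'|exact: at'].
have key i j : i != j -> a' i \in C -> ~ fconn (U `\` t')%fset b (a' j).
  move=> ij aiC bj; apply: (sep' i j ij); apply: (conn_trans (Ctot _ aiC)).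
  by apply: conn_trans bj; apply: (conn_sym esym); exact: fconn_sub bt'2.
move=> i j ij; rewrite /a2.
case: ifPn => aiC; case: ifPn => ajC H.
- apply: (sep' i j ij); apply: (conn_trans (Ctot _ aiC)).
  exact: (conn_sym esym (Ctot _ ajC)).
- by apply: (key i j ij aiC); exact: fconn_sub H.
- apply: (key j i _ ajC); first by rewrite eq_sym.
  by apply: (conn_sym esym); exact: fconn_sub H.
- by apply: (sep' i j ij); exact: fconn_sub H.
Qed.

End trifurcations.

(** * Planarity *)

Lemma adj_Z2P (c d : Z2) : adj_Z2 c d ->
  [\/ c.1 = d.1 /\ c.2 = d.2 + 1, c.1 = d.1 /\ d.2 = c.2 + 1,
      c.2 = d.2 /\ c.1 = d.1 + 1 | c.2 = d.2 /\ d.1 = c.1 + 1].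
Proof.
case: c d => [c1 c2] [d1 d2]; rewrite /adj_Z2 /dist2 /= => /eqP H.
have a1 : -1 <= c1 - d1 <= 1 by have := sqr_ge0 (c2 - d2); nia.
have b1 : -1 <= c2 - d2 <= 1 by have := sqr_ge0 (c1 - d1); nia.
have : c1 - d1 = -1 \/ (c1 - d1 = 0 \/ c1 - d1 = 1) by lia.
have : c2 - d2 = -1 \/ (c2 - d2 = 0 \/ c2 - d2 = 1) by lia.
move=> [Hb|[Hb|Hb]] [Ha|[Ha|Ha]]; rewrite Ha Hb in H => //;
  [constructor 2|constructor 4|constructor 3|constructor 1]; lia.
Qed.

Lemma adj_Z2_sym : symmetric adj_Z2.
Proof.
by move=> c d; rewrite /adj_Z2 /dist2 -(sqrrN (c.1 - _)) -(sqrrN (c.2 - _)) !opprB.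
Qed.

Lemma adj_up (x y : int) : adj_Z2 (x, y) (x, y + 1).
Proof. by rewrite /adj_Z2 /dist2 /= subrr opprD addNKr expr0n sqrrN. Qed.

Lemma adj_right (x y : int) : adj_Z2 (x, y) (x + 1, y).
Proof. by rewrite /adj_Z2 /dist2 /= subrr opprD addNKr expr0n sqrrN addr0. Qed.

(** The horizontal ray that leaves [v] to the right at height [v.2 + 1/2] meets
the step from [a] to [b]. *)
Definition crosses (v a b : Z2) : bool :=
  [&& a.1 == b.1, v.1 < a.1 &
    ((a.2 == v.2) && (b.2 == v.2 + 1)) || ((b.2 == v.2) && (a.2 == v.2 + 1))].

Fixpoint winding (v a : Z2) (p : seq Z2) : bool :=
  if p is b :: p' then crosses v a b (+) winding v b p' else false.

Lemma winding_cat v a p q :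
  winding v a (p ++ q) = winding v a p (+) winding v (last a p) q.
Proof. by elim: p a => [|b p IH] a //=; rewrite IH addbA. Qed.

(** Telescoping along the walk: the change of the crossing parity between two
rays is computed one step at a time. *)
Lemma winding_diff (U h : Z2 -> bool) v v' a p :
  (forall b c, U b -> U c -> adj_Z2 b c ->
    crosses v b c (+) crosses v' b c = h b (+) h c) ->
  path adj_Z2 a p -> all U (a :: p) ->
  winding v a p (+) winding v' a p = h a (+) h (last a p).
Proof.
move=> H; elim: p a => [|b p IH] a /=; first by rewrite addbb.
move=> /andP[ab bp] /and3P[Ua Ub Up].
rewrite addbACA H// IH//=; last by rewrite Ub.
by rewrite addbA -(addbA (h a)) addbb addbF.
Qed.

(** For a vertical step the parity does not change because a closed walk enters
and leaves the half-line between the two rays equally often. *)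
Lemma winding_adj v v' a p : path adj_Z2 a p -> last a p = a ->
  v \notin a :: p -> v' \notin a :: p -> adj_Z2 v v' ->
  winding v a p = winding v' a p.
Proof.
wlog : v v' / (v.1 = v'.1 /\ v'.2 = v.2 + 1) \/ (v.2 = v'.2 /\ v'.1 = v.1 + 1).
  move=> W ap la vp v'p vv'; have v'v : adj_Z2 v' v by rewrite adj_Z2_sym.
  have [[H1 H2]|[H1 H2]|[H1 H2]|[H1 H2]] := adj_Z2P vv'.
  - by apply/esym/W => //; left.
  - by apply: W => //; left.
  - by apply/esym/W => //; right.
  - by apply: W => //; right.
move=> Hv ap la vp v'p _.
pose h (z : Z2) := [&& (v.1 == v'.1), v.1 < z.1 & z.2 == v'.2].
suff : winding v a p (+) winding v' a p = h a (+) h (last a p).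
  by rewrite la addbb; case: winding; case: winding.
apply: (@winding_diff (fun z => (z != v) && (z != v'))) => //; last first.
  apply/allP => z zp; apply/andP; split; apply: contraTneq zp => ->//.
move=> b c /andP[bv bv'] /andP[cv cv'] /adj_Z2P bc.
move: bv bv' cv cv' bc Hv; rewrite /h /crosses -!pair_eqE /pair_eq.
case: v v' b c {h vp v'p} => [v1 v2] [w1 w2] [b1 b2] [c1 c2] /= ? ? ? ? H1 H2.
case: H1 => -[? ?]; case: H2 => -[? ?]; subst; lia.
Qed.

Lemma winding_conn v v' a p : path adj_Z2 a p -> last a p = a ->
  conn adj_Z2 (fun z => z \notin a :: p) v v' ->
  winding v a p = winding v' a p.
Proof.
move=> ap la vv'; pattern v'; apply: (conn_ind vv') => // y z vy IH yz zp.
by rewrite IH; apply: winding_adj => //; exact: conn_endr vy.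
Qed.

Fixpoint vseg (x y : int) (k : nat) : seq Z2 :=
  if k is k'.+1 then (x, y + 1) :: vseg x (y + 1) k' else [::].

Fixpoint hseg (x y : int) (k : nat) : seq Z2 :=
  if k is k'.+1 then (x + 1, y) :: hseg (x + 1) y k' else [::].

Lemma vseg_path x y k : path adj_Z2 (x, y) (vseg x y k).
Proof. by elim: k y => //= k IH y; rewrite adj_up IH. Qed.

Lemma hseg_path x y k : path adj_Z2 (x, y) (hseg x y k).
Proof. by elim: k x => //= k IH x; rewrite adj_right IH. Qed.

Lemma last_vseg x y k : last (x, y) (vseg x y k) = (x, y + k%:Z).
Proof. by elim: k y => [|k IH] y /=; rewrite ?IH; congr pair; lia. Qed.

Lemma last_hseg x y k : last (x, y) (hseg x y k) = (x + k%:Z, y).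
Proof. by elim: k x => [|k IH] x /=; rewrite ?IH; congr pair; lia. Qed.

Lemma mem_vseg x y k z : z \in vseg x y k ->
  z.1 = x /\ (y < z.2 <= y + k%:Z).
Proof.
elim: k y => //= k IH y; rewrite inE => /predU1P[->/=|/IH[]]; first lia.
by move=> ->; lia.
Qed.

Lemma mem_hseg x y k z : z \in hseg x y k ->
  z.2 = y /\ (x < z.1 <= x + k%:Z).
Proof.
elim: k x => //= k IH x; rewrite inE => /predU1P[->/=|/IH[]]; first lia.
by move=> ->; lia.
Qed.

Lemma winding_vseg v x y k : winding v (x, y) (vseg x y k) =
  (v.1 < x) && (y <= v.2 < y + k%:Z).
Proof.
by elim: k y => [|k IH] y /=; rewrite ?IH /crosses /=; lia.
Qed.

Lemma winding_hseg v x y k : winding v (x, y) (hseg x y k) = false.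
Proof.
elim: k x => [//|k IH] x /=; rewrite IH /crosses /=; lia.
Qed.

Lemma conn_col (U : Z2 -> bool) x y1 y2 : y1 <= y2 ->
  (forall y, y1 <= y <= y2 -> U (x, y)) -> conn adj_Z2 U (x, y1) (x, y2).
Proof.
move=> y12 UH; exists (vseg x y1 `|y2 - y1|%N); split.
- exact: vseg_path.
- by rewrite last_vseg; congr pair; lia.
- apply/allP => z; rewrite inE => /predU1P[->|/mem_vseg[z1 z2]].
    by apply: UH; lia.
  by rewrite (surjective_pairing z) z1; apply: UH; lia.
Qed.

Lemma conn_row (U : Z2 -> bool) x1 x2 y : x1 <= x2 ->
  (forall x, x1 <= x <= x2 -> U (x, y)) -> conn adj_Z2 U (x1, y) (x2, y).
Proof.
move=> x12 UH; exists (hseg x1 y `|x2 - x1|%N); split.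
- exact: hseg_path.
- by rewrite last_hseg; congr pair; lia.
- apply/allP => z; rewrite inE => /predU1P[->|/mem_hseg[z2 z1]].
    by apply: UH; lia.
  by rewrite (surjective_pairing z) z2; apply: UH; lia.
Qed.

(** The square of radius [n] without its corners: distinct points of its four
open sides have distinct neighbours outside. *)
Definition core (n : int) (c : Z2) : bool :=
  [&& - n <= c.1 <= n, - n <= c.2 <= n &
    ~~ (((c.1 == n) || (c.1 == - n)) && ((c.2 == n) || (c.2 == - n)))].

(** A parity form of the Jordan curve theorem. Close the connection from [f] to
[f'] by a path inside the square, first up from the bottom side and then to the
right side. On the row of height [y2] this path is crossed exactly once, so the
two ends of that row are separated by the closed walk; but the connection from
[g] to [g'] joins them without meeting it. *)
Lemma core_adjacent_sides (n : int) (U1 U2 : Z2 -> bool) f f' g g' (x y1 y2 y3 : int) :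
  2 <= n -> (forall z, U1 z -> ~~ core n z) -> (forall z, U2 z -> ~~ core n z) ->
  (forall z, U1 z -> U2 z -> False) ->
  - n < x < n -> - n < y2 < y1 -> y1 < n -> - n < y3 < n ->
  conn adj_Z2 U1 f f' -> conn adj_Z2 U2 g g' ->
  adj_Z2 f (n, y1) -> adj_Z2 f' (x, - n) ->
  adj_Z2 g (n, y2) -> adj_Z2 g' (- n, y3) -> False.
Proof.
move=> n2 U1D U2D U12 xn y21 y1n y3n [p [fp lp Up]] gg' ff ff' gg gg'1.
have fD : ~~ core n f by apply: U1D; case/andP: Up.
have f'D : ~~ core n f' by apply: U1D; rewrite -lp; apply: (allP Up); exact: mem_last.
set k := `|(y1 + n)%R|%N; set m := `|(n - x)%R|%N.
pose c := (x, - n) :: vseg x (- n) k ++ hseg x y1 m ++ [:: f].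
have lv : last (x, - n) (vseg x (- n) k) = (x, y1).
  by rewrite last_vseg; congr pair; lia.
have lh : last (x, y1) (hseg x y1 m) = (n, y1).
  by rewrite last_hseg; congr pair; lia.
have cpath : path adj_Z2 f (p ++ c).
  rewrite cat_path fp lp /= ff' cat_path vseg_path lv cat_path hseg_path lh /=.
  by rewrite adj_Z2_sym ff.
have clast : last f (p ++ c) = f by rewrite last_cat /= !last_cat.
have memc z : z \in f :: p ++ c ->
    U1 z \/ (z.1 = x /\ - n <= z.2 <= y1) \/ (z.2 = y1 /\ x <= z.1 <= n).
  rewrite inE mem_cat inE !mem_cat inE => /predU1P[->|]; first by left; case/andP: Up.
  case/or3P => [zp|/eqP ->/=|]; first by left; apply: (allP Up); rewrite inE zp orbT.
    by right; left; clear -y21; lia.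
  case/or3P => [/mem_vseg[]|/mem_hseg[]|/eqP ->].
  - by move=> zx zy; right; left; clear -zx zy y21; lia.
  - by move=> zx zy; right; right; clear -zx zy xn; lia.
  - by left; case/andP: Up.
pose a : Z2 := (n, y2); pose b : Z2 := (- n, y2).
have notc z : core n z || U2 z -> z \in f :: p ++ c ->
    core n z /\ ((z.1 = x /\ - n <= z.2 <= y1) \/ (z.2 = y1 /\ x <= z.1 <= n)).
  move=> /orP[zD /memc[/U1D|//]|Uz /memc[/U12/(_ Uz)//|H]]; first by rewrite zD.
  suff zD : core n z by have := U2D z Uz; rewrite zD.
  clear -n2 xn y21 y1n H; case: z H => [z1 z2] /= H.
  by rewrite /core /=; case: H => -[-> /andP[? ?]]; lia.
have conng : conn adj_Z2 (fun z => z \notin f :: p ++ c) a b.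
  have aD : a \notin f :: p ++ c.
    by apply/negP => /notc[|/= _]; rewrite /core /=; clear -n2 xn y21 y1n; lia.
  have U2c z : U2 z -> z \notin f :: p ++ c.
    by move=> Uz; apply/negP => /notc; rewrite Uz orbT => /(_ isT)[zD]; have := U2D _ Uz; rewrite zD.
  have g'D : conn adj_Z2 (fun z => z \notin f :: p ++ c) a g'.
    apply: (conn_trans (y := g)).
      by apply: conn_adj => //; [rewrite adj_Z2_sym|apply: U2c; exact: conn_endl gg'].
    exact: conn_sub gg'.
  have colc y : - n < y < n -> (- n, y) \notin f :: p ++ c.
    by move=> yn; apply/negP => /notc[|/= _]; rewrite /core /=; clear -n2 xn y21 y1n yn; lia.
  apply: (conn_trans g'D); apply: (conn_trans (y := (- n, y3))).
    by apply: conn_adj => //; [exact: conn_endr g'D|apply: colc].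
  have [y32|/ltW y23] := lerP y3 y2.
    by apply: conn_col => // y yy; apply: colc; clear -yy y21 y1n y3n; lia.
  apply: (conn_sym adj_Z2_sym).
  by apply: conn_col => // y yy; apply: colc; clear -yy y21 y1n y3n; lia.
suff : winding a f (p ++ c) (+) winding b f (p ++ c) = true.
  by rewrite (winding_conn cpath clast conng) addbb.
have -> : winding a f (p ++ c) (+) winding b f (p ++ c) =
    (winding a f p (+) winding b f p) (+)
    (winding a (last f p) c (+) winding b (last f p) c).
  by rewrite !winding_cat addbACA.
rewrite (@winding_diff U1 xpred0)//; last first.
  move=> u v /U1D uD /U1D vD _; move: uD vD; rewrite /crosses /core /=.
  by clear -n2 xn y21 y1n; case: u v => [u1 u2] [v1 v2] /=; lia.
rewrite lp /= !winding_cat lv lh !winding_vseg !winding_hseg /= !addbF.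
have e1 w : (w == a) || (w == b) -> crosses w (n, y1) f = false.
  move: fD (adj_Z2P ff); rewrite /crosses /core /a /b.
  clear -n2 xn y21 y1n; case: w f => [w1 w2] [f1 f2] /= fD H /orP[] /eqP[-> ->].
    by case: H => H; lia.
  by case: H => H; lia.
have e2 w : (w == a) || (w == b) -> crosses w f' (x, - n) = false.
  move: f'D (adj_Z2P ff'); rewrite /crosses /core /a /b.
  clear -n2 xn y21 y1n; case: w f' => [w1 w2] [f1 f2] /= fD H /orP[] /eqP[-> ->].
    by case: H => H; lia.
  by case: H => H; lia.
by rewrite !e1 ?eqxx ?orbT// !e2 ?eqxx ?orbT// /a /b /=; clear -n2 xn y21 y1n; lia.
Qed.

(** * Sums over the spins of finitely many sites *)

Section spin_sums.
Variables (R : realFieldType) (S : eqType).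
Implicit Types (l : seq S) (sigma eta : S -> bool) (F G : (S -> bool) -> R).

Definition upd sigma (x : S) (b : bool) : S -> bool :=
  fun y => if y == x then b else sigma y.

(** Summing over one spin at a time makes conditioning a concatenation of lists and
allows induction on the number of sites. *)
Fixpoint ssum l F sigma : R :=
  if l is x :: l' then ssum l' F (upd sigma x true) + ssum l' F (upd sigma x false)
  else F sigma.

Definition agree_off l sigma eta := forall x, x \notin l -> eta x = sigma x.

Lemma agree_off_upd x l sigma b eta :
  agree_off l (upd sigma x b) eta -> agree_off (x :: l) sigma eta.
Proof.
by move=> H y; rewrite inE negb_or => /andP[yx yl]; rewrite H// /upd (negbTE yx).
Qed.

Lemma eq_ssum l F G sigma :
  (forall eta, agree_off l sigma eta -> F eta = G eta) ->
  ssum l F sigma = ssum l G sigma.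
Proof.
elim: l sigma => [|x l IH] sigma H /=; first exact: H.
by congr (_ + _); apply: IH => eta /agree_off_upd/H.
Qed.

Lemma ler_ssum l F G sigma :
  (forall eta, agree_off l sigma eta -> F eta <= G eta) ->
  ssum l F sigma <= ssum l G sigma.
Proof.
elim: l sigma => [|x l IH] sigma H /=; first exact: H.
by apply: lerD; apply: IH => eta /agree_off_upd/H.
Qed.

Lemma ssum0 l sigma : ssum l (fun=> 0) sigma = 0.
Proof. by elim: l sigma => //= x l IH sigma; rewrite !IH addr0. Qed.

Lemma ssum_ge0 l F sigma : (forall eta, 0 <= F eta) -> 0 <= ssum l F sigma.
Proof. by move=> F0; rewrite -(ssum0 l sigma); apply: ler_ssum. Qed.

Lemma ssum_gt0 l F sigma : (forall eta, 0 < F eta) -> 0 < ssum l F sigma.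
Proof. by move=> F0; elim: l sigma => //= x l IH sigma; rewrite addr_gt0. Qed.

Lemma ssumD l F G sigma :
  ssum l (fun eta => F eta + G eta) sigma = ssum l F sigma + ssum l G sigma.
Proof. by elim: l sigma => //= x l IH sigma; rewrite !IH addrACA. Qed.

Lemma ssumZ l F (g : R) sigma :
  ssum l (fun eta => g * F eta) sigma = g * ssum l F sigma.
Proof. by elim: l sigma => //= x l IH sigma; rewrite !IH mulrDr. Qed.

Lemma ssum_sum (I : Type) (r : seq I) (P : pred I) (F : I -> (S -> bool) -> R)
    l sigma :
  ssum l (fun eta => \sum_(i <- r | P i) F i eta) sigma =
  \sum_(i <- r | P i) ssum l (F i) sigma.
Proof.
elim: r => [|i r IH]; first by under eq_ssum do rewrite big_nil; rewrite big_nil ssum0.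
rewrite big_cons; case: ifP => Pi; rewrite -IH -?ssumD.
  by apply: eq_ssum => eta _; rewrite big_cons Pi.
by apply: eq_ssum => eta _; rewrite big_cons Pi.
Qed.

Lemma ssum_cat l1 l2 F sigma : ssum (l1 ++ l2) F sigma = ssum l1 (ssum l2 F) sigma.
Proof. by elim: l1 sigma => //= x l IH sigma; rewrite !IH. Qed.

Lemma ssum_agree l F sigma eta : agree_off l sigma eta -> ssum l F eta = ssum l F sigma.
Proof.
elim: l sigma eta => [|x l IH] sigma eta H /=.
  by congr F; apply/funext => x; exact: H.
congr (_ + _); apply: IH => y yl; rewrite /upd; case: ifPn => // yx;
  by apply: H; rewrite inE negb_or yx.
Qed.

Lemma upd_comm sigma x y b c : x != y ->
  upd (upd sigma x b) y c = upd (upd sigma y c) x b.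
Proof.
move=> xy; apply/funext => z; rewrite /upd.
by have [->|//] := eqVneq z y; rewrite eq_sym (negbTE xy).
Qed.

Lemma ssum_move p x q F sigma : ssum (p ++ x :: q) F sigma = ssum (x :: p ++ q) F sigma.
Proof.
elim: p sigma => // y p IH sigma; rewrite cat_cons [LHS]/= !IH /=.
have [->//|xy] := eqVneq y x.
by rewrite !(upd_comm _ _ _ xy) addrACA.
Qed.

Lemma ssum_perm l1 l2 F sigma : perm_eq l1 l2 -> ssum l1 F sigma = ssum l2 F sigma.
Proof.
elim: l1 l2 sigma => [|x l1 IH] l2 sigma; first by rewrite perm_sym => /perm_nilP ->.
move=> p12; have xl2 : x \in l2 by rewrite -(perm_mem p12) mem_head.
case/splitPr: xl2 p12 => p q p12; rewrite ssum_move /=; congr (_ + _); apply: IH;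
  by rewrite -(perm_cons x) (perm_trans p12)// perm_catC /= perm_cons perm_catC.
Qed.

Lemma ssum_neg l F sigma :
  ssum l (fun eta => F (negb \o eta)) sigma = ssum l F (negb \o sigma).
Proof.
elim: l sigma => //= x l IH sigma; rewrite !IH addrC.
by congr (ssum _ _ _ + ssum _ _ _); apply/funext => y; rewrite /upd /=; case: ifP.
Qed.

Lemma ssum_comp (f g : S -> S) l F sigma : cancel f g -> cancel g f ->
  ssum l (fun eta => F (eta \o f)) sigma = ssum (map g l) F (sigma \o f).
Proof.
move=> fK gK; elim: l sigma => //= x l IH sigma; rewrite !IH.
congr (ssum _ _ _ + ssum _ _ _); apply/funext => y; rewrite /upd /=;
  by rewrite (can2_eq fK gK).
Qed.

(** ** The four functions theorem *)

(** The case of one site. With [t = c1 * d0], [u = a1 * b0], [v = a0 * b1] the other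
products give [u * v <= t * (c0 * d1)], and [(t - u) * (t - v) >= 0]. *)
Lemma four_functions1 (a1 a0 b1 b0 c1 c0 d1 d0 : R) :
  0 <= a1 -> 0 <= a0 -> 0 <= b1 -> 0 <= b0 ->
  0 <= c1 -> 0 <= c0 -> 0 <= d1 -> 0 <= d0 ->
  a1 * b1 <= c1 * d1 -> a0 * b0 <= c0 * d0 ->
  a1 * b0 <= c1 * d0 -> a0 * b1 <= c1 * d0 ->
  (a1 + a0) * (b1 + b0) <= (c1 + c0) * (d1 + d0).
Proof.
move=> a10 a00 b10 b00 c10 c00 d10 d00 h11 h00 h10 h01.
suff : a1 * b0 + a0 * b1 <= c1 * d0 + c0 * d1 by nra.
set t := c1 * d0 in h10 h01 *; set u := a1 * b0 in h10 *; set v := a0 * b1 in h01 *.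
have t0 : 0 <= t by apply: mulr_ge0.
have u0 : 0 <= u by apply: mulr_ge0.
have v0 : 0 <= v by apply: mulr_ge0.
have s0 : 0 <= c0 * d1 by apply: mulr_ge0.
have uv : u * v <= t * (c0 * d1).
  have -> : u * v = (a1 * b1) * (a0 * b0) by rewrite /u /v; ring.
  have -> : t * (c0 * d1) = (c1 * d1) * (c0 * d0) by rewrite /t; ring.
  by apply: ler_pM => //; apply: mulr_ge0.
have [t0'|/eqP t0'] := eqVneq t 0; first by rewrite t0' in h10 h01; lra.
have tp : 0 < t by rewrite lt_def t0 andbT; apply/eqP.
rewrite -(ler_pM2l tp).
have : 0 <= (t - u) * (t - v) by apply: mulr_ge0; rewrite subr_ge0.
by lra.
Qed.

Definition cjoin sigma eta : S -> bool := fun x => sigma x || eta x.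
Definition cmeet sigma eta : S -> bool := fun x => sigma x && eta x.

(** The theorem of Ahlswede and Daykin. Summing out one site preserves the
hypothesis. *)
Lemma four_functions (a b c d : (S -> bool) -> R) :
  (forall s, 0 <= a s) -> (forall s, 0 <= b s) ->
  (forall s, 0 <= c s) -> (forall s, 0 <= d s) ->
  (forall s t, a s * b t <= c (cjoin s t) * d (cmeet s t)) ->
  forall l s t,
    ssum l a s * ssum l b t <= ssum l c (cjoin s t) * ssum l d (cmeet s t).
Proof.
move=> a0 b0 c0 d0 H; elim=> [|x l IH] s t /=; first exact: H.
have updE i j : upd (cjoin s t) x (i || j) = cjoin (upd s x i) (upd t x j) /\
                upd (cmeet s t) x (i && j) = cmeet (upd s x i) (upd t x j).
  by split; apply/funext => y; rewrite /upd /cjoin /cmeet; case: ifP.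
have IHb i j : ssum l a (upd s x i) * ssum l b (upd t x j) <=
    ssum l c (upd (cjoin s t) x (i || j)) * ssum l d (upd (cmeet s t) x (i && j)).
  by have [-> ->] := updE i j; exact: IH.
apply: four_functions1; try exact: ssum_ge0.
- exact: (IHb true true).
- exact: (IHb false false).
- exact: (IHb true false).
- exact: (IHb false true).
Qed.

End spin_sums.

(** * The Ising weights *)

Lemma adj_slab_sym : symmetric adj_slab.
Proof.
by move=> x y; rewrite /adj_slab /dist2 -(sqrrN (x.1.1 - _)) -(sqrrN (x.1.2 - _))
  -(sqrrN (x.2%:Z - _)) !opprB.
Qed.

Lemma adj_slab_neq x y : adj_slab x y -> x != y.
Proof. by move=> xy; apply/eqP => xy'; move: xy; rewrite xy' /adj_slab /dist2 !subrr. Qed.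

Definition bonds (L : {fset slab}) := fset_set (edges_touching L).

Lemma bondsP (L : {fset slab}) e : reflect (exists x y, [/\ e = [fset x; y]%fset,
  adj_slab x y & (x \in L) || (y \in L)]) (e \in bonds L).
Proof.
rewrite in_fset_set; last exact: finite_edges_touching.
by apply: (iffP idP) => [|H]; rewrite inE.
Qed.

Section ising_weight.
Context {R : realType}.
Implicit Types (L M : {fset slab}) (sigma tau : config).

Lemma interactionE L sigma : interaction L sigma =
  \sum_(e <- bonds L) \prod_(x <- e) (spin (sigma x) : R).
Proof. by rewrite /interaction fsbig_finite//; exact: finite_edges_touching. Qed.

Lemma prod_bond (x y : slab) (F : slab -> R) : adj_slab x y ->
  \prod_(z <- [fset x; y]%fset) F z = F x * F y.
Proof.
move=> /adj_slab_neq xy; rewrite big_fsetU1 ?inE//= big_seq_fset1.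
by [].
Qed.

Lemma interaction_supermodular L sigma tau :
  interaction L sigma + interaction L tau <=
  interaction L (cjoin sigma tau) + interaction L (cmeet sigma tau) :> R.
Proof.
rewrite !interactionE -!big_split /= big_seq [leRHS]big_seq.
apply: ler_sum => e /bondsP[x [y [-> xy _]]].
rewrite !prod_bond// /cjoin /cmeet /spin.
by case: (sigma x); case: (sigma y); case: (tau x); case: (tau y) => /=; lra.
Qed.

Lemma eq_interaction L sigma tau :
  (forall x y, adj_slab x y -> x \in L -> sigma x = tau x /\ sigma y = tau y) ->
  interaction L sigma = interaction L tau :> R.
Proof.
move=> H; rewrite !interactionE; apply: eq_big_seq => e.
case/bondsP => x [y [-> xy /orP[xL|yL]]]; rewrite !prod_bond//.
  by have [-> ->] := H _ _ xy xL.
by rewrite adj_slab_sym in xy; have [-> ->] := H _ _ xy yL.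
Qed.

(** Source of the Markov property: the bonds that do not touch [L] contribute a
term that is blind to the spins in [L]. *)
Lemma interaction_rest L M : (L `<=` M)%fset -> exists r : config -> R,
  (forall sigma, interaction M sigma = interaction L sigma + r sigma) /\
  (forall sigma tau, agree_off L sigma tau -> r tau = r sigma).
Proof.
move=> LM; exists (fun sigma => \sum_(e <- [fset e in bonds M | e \notin bonds L]%fset)
  \prod_(x <- e) (spin (sigma x) : R)); split=> [sigma|sigma tau st].
  rewrite !interactionE (big_fsetID _ (fun e => e \in bonds L)) /=; congr (_ + _).
  apply: congr_big => //; congr enum_fset; apply/fsetP => e; rewrite !inE.
  apply/andb_idl => /bondsP[x [y [-> xy xyL]]]; apply/bondsP; exists x, y; split=> //.
  by case/orP: xyL => /(fsubsetP LM) ->; rewrite ?orbT.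
apply: eq_big_seq => e; rewrite !inE => /andP[/bondsP[x [y [-> xy _]]] neL].
have /norP[xL yL] : ~~ ((x \in L) || (y \in L)).
  by apply: contra neL => xyL; apply/bondsP; exists x, y.
by rewrite !prod_bond// !st.
Qed.

Lemma interaction_neg L sigma : interaction L (negb \o sigma) = interaction L sigma :> R.
Proof.
rewrite !interactionE; apply: eq_big_seq => e /bondsP[x [y [-> xy _]]].
by rewrite !prod_bond//= /spin; case: (sigma x); case: (sigma y) => /=; lra.
Qed.

Lemma interaction_comp (f g : slab -> slab) L M sigma : cancel f g -> cancel g f ->
  (forall x y, adj_slab (f x) (f y) = adj_slab x y) ->
  (forall x, (f x \in M) = (x \in L)) ->
  interaction L (sigma \o f) = interaction M sigma :> R.
Proof.
move=> fK gK fadj fM; rewrite !interactionE.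
pose img (e : {fset slab}) := [fset f x | x in e]%fset.
have -> : bonds M = [fset img e | e in bonds L]%fset.
  apply/fsetP => e; apply/bondsP/imfsetP => [[x [y [-> xy xyM]]]|].
    exists [fset g x; g y]%fset => /=.
      apply/bondsP; exists (g x), (g y).
      by rewrite -fadj !gK -!fM !gK.
    apply/fsetP => z; rewrite !inE; apply/idP/imfsetP.
      by case/orP => /eqP ->; [exists (g x)|exists (g y)];
        rewrite ?gK//= !inE eqxx ?orbT.
    by case=> w /=; rewrite !inE => /orP[] /eqP -> ->; rewrite gK eqxx ?orbT.
  case=> e' /= /bondsP[x [y [-> xy xyL]]] ->; exists (f x), (f y).
  split; [|by rewrite fadj|by rewrite !fM].
  apply/fsetP => z; rewrite !inE; apply/imfsetP/idP.
    by case=> w /=; rewrite !inE => /orP[] /eqP -> ->; rewrite eqxx ?orbT.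
  by case/orP => /eqP ->; [exists x|exists y] => //=; rewrite !inE eqxx ?orbT.
rewrite big_imfset /=; last first.
  move=> e1 e2 _ _ /fsetP E; apply/fsetP => z.
  have mem_f (e : {fset slab}) : (f z \in img e) = (z \in e).
    apply/imfsetP/idP => [[w /= we /(can_inj fK) -> //]|ze]; by exists z.
  by rewrite -!mem_f E.
apply: eq_big_seq => e _; rewrite big_imfset//=.
by move=> x y _ _; exact: (can_inj fK).
Qed.

Variable beta : R.
Hypothesis beta_ge0 : 0 <= beta.

Definition gweight L sigma : R := expR (beta * interaction L sigma).

Lemma gweight_gt0 L sigma : 0 < gweight L sigma.
Proof. exact: expR_gt0. Qed.

Lemma gweight_lattice L sigma tau : gweight L sigma * gweight L tau <=
  gweight L (cjoin sigma tau) * gweight L (cmeet sigma tau).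
Proof.
rewrite /gweight -!expRD ler_expR -!mulrDr ler_wpM2l//.
exact: interaction_supermodular.
Qed.

Lemma gweight_rest L M : (L `<=` M)%fset -> exists r : config -> R,
  [/\ forall sigma, 0 < r sigma,
      forall sigma, gweight M sigma = gweight L sigma * r sigma &
      forall sigma tau, agree_off L sigma tau -> r tau = r sigma].
Proof.
move=> /interaction_rest[r [rE rL]]; exists (fun sigma => expR (beta * r sigma)).
split=> [sigma|sigma|sigma tau st]; first exact: expR_gt0.
  by rewrite /gweight rE mulrDr expRD.
by rewrite (rL _ _ st).
Qed.

(** Finite energy: only the bonds at [x] change, so the constant does not depend on
the volume. *)
Lemma gweight_upd (x : slab) : exists2 c : R, 0 < c & forall M sigma b, x \in M ->
  gweight M sigma <= c * gweight M (upd sigma x b).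
Proof.
pose m : R := \sum_(e <- bonds [fset x]%fset) 1.
have int_le sigma : `|interaction [fset x]%fset sigma| <= m.
  rewrite interactionE; apply: le_trans (ler_norm_sum _ _ _) _.
  rewrite /m big_seq [leRHS]big_seq; apply: ler_sum => e /bondsP[y [z [-> yz _]]].
  rewrite prod_bond// /spin.
  by case: (sigma y); case: (sigma z); rewrite ?mulN1r ?mul1r ?opprK ?normrN normr1.
exists (expR (beta * m) * expR (beta * m)); first by rewrite mulr_gt0 ?expR_gt0.
move=> M sigma b xM.
have [r [r0 rE rL]] : exists r : config -> R, [/\ forall sigma, 0 < r sigma,
      forall sigma, gweight M sigma = gweight [fset x]%fset sigma * r sigma &
      forall sigma tau, agree_off [fset x]%fset sigma tau -> r tau = r sigma].
  by apply: gweight_rest; rewrite fsub1set.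
rewrite !rE (rL sigma (upd sigma x b)); last first.
  by move=> y; rewrite inE /upd => /negbTE ->.
rewrite mulrA (ler_wpM2r (ltW (r0 _)))// -mulrA /gweight -!expRD ler_expR -!mulrDr.
rewrite ler_wpM2l//; have := int_le sigma; have := int_le (upd sigma x b).
by rewrite !ler_norml => /andP[? ?] /andP[? ?]; lra.
Qed.

End ising_weight.

(** * Finite-volume Gibbs expectations *)

Definition cle (sigma tau : config) := forall x, sigma x -> tau x.

Definition spin_increasing (R : realType) (F : config -> R) :=
  forall sigma tau, cle sigma tau -> F sigma <= F tau.

Definition local_on (T : Type) (L : {fset slab}) (F : config -> T) :=
  forall sigma tau, (forall x, x \in L -> sigma x = tau x) -> F sigma = F tau.

Definition off (T : Type) (L : {fset slab}) (F : config -> T) :=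
  forall sigma tau, agree_off L sigma tau -> F tau = F sigma.

Lemma ssum_rel (R : realFieldType) (S : eqType) (l : seq S)
    (F G : (S -> bool) -> R) eta eta' :
  (forall sigma sigma', agree_off l eta sigma -> agree_off l eta' sigma' ->
    (forall x, x \in l -> sigma x = sigma' x) -> F sigma = G sigma') ->
  ssum l F eta = ssum l G eta'.
Proof.
elim: l eta eta' => [|x l IH] eta eta' H /=; first exact: H.
congr (_ + _); apply: IH => sigma sigma' s s' ss'; apply: H.
- exact: agree_off_upd s.
- exact: agree_off_upd s'.
- move=> y; rewrite inE => /predU1P[->|]; last exact: ss'.
  by have [/ss'//|xl] := boolP (x \in l); rewrite s// s'// /upd eqxx.
- exact: agree_off_upd s.
- exact: agree_off_upd s'.
- move=> y; rewrite inE => /predU1P[->|]; last exact: ss'.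
  by have [/ss'//|xl] := boolP (x \in l); rewrite s// s'// /upd eqxx.
Qed.

Lemma cle_join sigma tau : cle sigma tau -> cjoin sigma tau = tau.
Proof.
move=> st; apply/funext => x; rewrite /cjoin.
by have [/st ->//|] := boolP (sigma x).
Qed.

Lemma cle_meet sigma tau : cle sigma tau -> cmeet sigma tau = sigma.
Proof.
move=> st; apply/funext => x; rewrite /cmeet.
by have [/st ->//|] := boolP (sigma x).
Qed.

Lemma cle_joinl sigma tau : cle sigma (cjoin sigma tau).
Proof. by move=> x sx; rewrite /cjoin sx. Qed.

Lemma cle_joinr sigma tau : cle tau (cjoin sigma tau).
Proof. by move=> x sx; rewrite /cjoin sx orbT. Qed.

Section gibbs.
Context {R : realType}.
Variable beta : R.
Hypothesis beta_ge0 : 0 <= beta.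
Implicit Types (L M : {fset slab}) (eta sigma tau : config) (F G : config -> R).

Local Notation w := (gweight beta).

Definition gibbs L eta F : R :=
  ssum L (fun sigma => w L sigma * F sigma) eta / ssum L (w L) eta.

Lemma partition_gt0 L eta : 0 < ssum L (w L) eta.
Proof. by apply: ssum_gt0 => sigma; exact: gweight_gt0. Qed.

Lemma partition_ge0 L eta : 0 <= ssum L (w L) eta.
Proof. exact/ltW/partition_gt0. Qed.

Lemma gweight_ge0 L sigma : 0 <= w L sigma.
Proof. exact/ltW/gweight_gt0. Qed.

Lemma eq_gibbs L eta F G : (forall sigma, agree_off L eta sigma -> F sigma = G sigma) ->
  gibbs L eta F = gibbs L eta G.
Proof. by move=> FG; congr (_ / _); apply: eq_ssum => sigma s; rewrite FG. Qed.

Lemma ler_gibbs L eta F G : (forall sigma, agree_off L eta sigma -> F sigma <= G sigma) ->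
  gibbs L eta F <= gibbs L eta G.
Proof.
move=> FG; rewrite ler_wpM2r ?invr_ge0 ?partition_ge0//.
by apply: ler_ssum => sigma s; rewrite ler_wpM2l ?gweight_ge0 ?FG.
Qed.

Lemma gibbsD L eta F G : gibbs L eta (fun s => F s + G s) = gibbs L eta F + gibbs L eta G.
Proof.
rewrite /gibbs -mulrDl -ssumD; congr (_ / _); apply: eq_ssum => s _.
exact: mulrDr.
Qed.

Lemma gibbsZ L eta F (c : R) : gibbs L eta (fun s => c * F s) = c * gibbs L eta F.
Proof.
rewrite /gibbs mulrA -ssumZ; congr (_ / _); apply: eq_ssum => s _.
exact: mulrCA.
Qed.

Lemma gibbsB L eta F G : gibbs L eta (fun s => F s - G s) = gibbs L eta F - gibbs L eta G.
Proof.
rewrite -[RHS](congr2 +%R erefl (mulN1r _)) -gibbsZ -gibbsD.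
by apply: eq_gibbs => s _; rewrite mulN1r.
Qed.

Lemma gibbs_cst L eta (c : R) : gibbs L eta (fun=> c) = c.
Proof.
rewrite /gibbs; under eq_ssum do rewrite mulrC.
by rewrite ssumZ mulfK// gt_eqF// partition_gt0.
Qed.

Lemma gibbs_sum (I : Type) (r : seq I) (P : pred I) (F : I -> config -> R) L eta :
  gibbs L eta (fun s => \sum_(i <- r | P i) F i s) = \sum_(i <- r | P i) gibbs L eta (F i).
Proof.
rewrite /gibbs -mulr_suml -ssum_sum; congr (_ / _); apply: eq_ssum => s _.
exact: mulr_sumr.
Qed.

(** The four functions are the weight times [F], [G], [F * G] and 1. *)
Lemma gibbs_fkg L eta F G : (forall s, 0 <= F s) -> (forall s, 0 <= G s) ->
  spin_increasing F -> spin_increasing G ->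
  gibbs L eta F * gibbs L eta G <= gibbs L eta (fun s => F s * G s).
Proof.
move=> F0 G0 Fi Gi; rewrite /gibbs mulrACA -invfM ler_pdivrMr ?mulr_gt0 ?partition_gt0//.
rewrite mulrA divfK ?gt_eqF ?partition_gt0//.
have w0 := gweight_ge0 L.
have Ej : cjoin eta eta = eta by apply: cle_join.
have Em : cmeet eta eta = eta by apply: cle_meet.
rewrite -{3}Ej -{5}Em.
apply: (four_functions (a := fun s => w L s * F s) (b := fun s => w L s * G s)) => //.
- by move=> s; rewrite mulr_ge0.
- by move=> s; rewrite mulr_ge0.
- by move=> s; rewrite !mulr_ge0.
move=> s t; rewrite mulrACA.
rewrite (mulrAC _ _ (w L (cmeet s t))); apply: ler_pM; rewrite ?mulr_ge0//.
  exact: gweight_lattice.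
by apply: ler_pM => //; [apply: Fi; exact: cle_joinl|apply: Gi; exact: cle_joinr].
Qed.

(** The four functions theorem applied with two different boundary conditions. *)
Lemma gibbs_mono L eta eta' F : (forall s, 0 <= F s) -> spin_increasing F ->
  cle eta eta' -> gibbs L eta F <= gibbs L eta' F.
Proof.
move=> F0 Fi ee'; rewrite ler_pdivrMr ?partition_gt0// mulrAC ler_pdivlMr ?partition_gt0//.
rewrite -{2}(cle_join ee') -{3}(cle_meet ee').
have w0 := gweight_ge0 L.
apply: (four_functions (a := fun s => w L s * F s)) => //.
- by move=> s; rewrite mulr_ge0.
- by move=> s; rewrite mulr_ge0.
move=> s t; rewrite mulrAC [leRHS]mulrAC; apply: ler_pM; rewrite ?mulr_ge0//.
  exact: gweight_lattice.
by apply: Fi; exact: cle_joinl.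
Qed.

(** The Markov property: the bonds that do not touch [L] give a factor that is
constant along the inner sum over the spins in [L], so it cancels against the
normalization. *)
Lemma gibbs_tower L M eta F G : (L `<=` M)%fset -> off L G ->
  gibbs M eta (fun s => G s * F s) = gibbs M eta (fun s => G s * gibbs L s F).
Proof.
move=> LM GL; have [r [r0 rE rL]] := gweight_rest beta LM.
have pM : perm_eq M ((M `\` L)%fset ++ L : seq slab).
  apply: uniq_perm; rewrite ?fset_uniq ?cat_uniq ?fset_uniq ?andbT//=.
    by apply/hasPn => x; rewrite inE => ->.
  by move=> x; rewrite mem_cat inE; case: (boolP (x \in L)) => xL /=; [exact: (fsubsetP LM)|rewrite orbF].
congr (_ / _); rewrite !(ssum_perm _ _ pM) !ssum_cat; apply: eq_ssum => s _.
have pull (H : config -> R) : ssum L (fun t => w M t * (G t * H t)) s =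
    (r s * G s) * ssum L (fun t => w L t * H t) s.
  rewrite -ssumZ; apply: eq_ssum => t st; rewrite rE (rL _ _ st) (GL _ _ st).
  by ring.
rewrite !pull; congr (_ * _).
have -> : ssum L (fun t => w L t * gibbs L t F) s =
    ssum L (fun t => gibbs L s F * w L t) s.
  apply: eq_ssum => t st; rewrite mulrC; congr (_ * _).
  by rewrite /gibbs !(ssum_agree _ st).
by rewrite ssumZ divfK// gt_eqF// partition_gt0.
Qed.

Lemma gibbs_bc L eta eta' F : local_on L F ->
  (forall x y, x \in L -> y \notin L -> adj_slab x y -> eta y = eta' y) ->
  gibbs L eta F = gibbs L eta' F.
Proof.
move=> FL H.
have wE s t : agree_off L eta s -> agree_off L eta' t ->
    (forall x, x \in L -> s x = t x) -> w L s = w L t.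
  move=> es et st; rewrite /gweight; congr (expR (_ * _)).
  apply: eq_interaction => x y xy xL; split; first exact: st.
  by have [/st//|yL] := boolP (y \in L); rewrite es// et//; exact: H xL yL xy.
congr (_ / _); apply: ssum_rel => s t es et st; last exact: wE.
by rewrite (wE s t)// (FL s t).
Qed.

Lemma gibbs_neg L eta F :
  gibbs L eta (fun s => F (negb \o s)) = gibbs L (negb \o eta) F.
Proof.
have wE s : w L s = w L (negb \o s) by rewrite /gweight interaction_neg.
congr (_ / _).
  rewrite -(ssum_neg L (fun s => w L s * F s)).
  by apply: eq_ssum => s _; rewrite wE.
by rewrite -ssum_neg; apply: eq_ssum => s _; rewrite wE.
Qed.

Lemma gibbs_comp (f g : slab -> slab) L M eta F : cancel f g -> cancel g f ->
  (forall x y, adj_slab (f x) (f y) = adj_slab x y) ->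
  (forall x, (f x \in M) = (x \in L)) ->
  gibbs M eta (fun s => F (s \o f)) = gibbs L (eta \o f) F.
Proof.
move=> fK gK fadj fM.
have wE s : w M s = w L (s \o f).
  by rewrite /gweight (interaction_comp s fK gK fadj fM).
have p : perm_eq (map g M) L.
  apply: uniq_perm; rewrite ?map_inj_uniq ?fset_uniq//; first exact: can_inj gK.
  move=> x; rewrite -fM; apply/mapP/idP => [[y yM ->]|xM]; first by rewrite gK.
  by exists (f x) => //; rewrite fK.
congr (_ / _).
  rewrite -(ssum_perm _ _ p) -(ssum_comp _ (fun s => w L s * F s) _ fK gK).
  by apply: eq_ssum => s _; rewrite wE.
rewrite -(ssum_perm _ _ p) -(ssum_comp _ _ _ fK gK).
by apply: eq_ssum => s _; rewrite wE.
Qed.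

(** Finite energy for expectations: sum over the spin at [x] last. *)
Lemma gibbs_force (x : slab) : exists2 c : R, 0 < c & forall M eta F, x \in M ->
  (forall s, 0 <= F s) -> off [fset x]%fset F ->
  c * gibbs M eta F <= gibbs M eta (fun s => (s x)%:R * F s).
Proof.
have [c c0 H] := gweight_upd beta_ge0 x.
exists (1 + c)^-1; first by rewrite invr_gt0 addr_gt0.
move=> M eta F xM F0 Fx; rewrite mulrC ler_pdivrMr ?addr_gt0//.
rewrite mulrC -gibbsZ /gibbs ler_wpM2r ?invr_ge0 ?partition_ge0//.
have pM : perm_eq M ((M `\ x)%fset ++ [:: x] : seq slab).
  apply: uniq_perm; rewrite ?fset_uniq ?cat_uniq ?fset_uniq ?andbT//=.
    by rewrite !inE eqxx.
  move=> y; rewrite mem_cat !inE; case: eqVneq => [->|_] //=.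
  by rewrite orbF.
rewrite !(ssum_perm _ _ pM) !ssum_cat; apply: ler_ssum => s _ /=.
have FE b : F (upd s x b) = F s.
  by apply: Fx => y; rewrite inE /upd => /negbTE ->.
have updE b : upd s x b x = b by rewrite /upd eqxx.
rewrite !FE !updE /= mul1r mul0r !mulr0 addr0 -mulrDl mulrCA.
rewrite mulrA ler_wpM2r//.
have := H M (upd s x false) true xM.
have -> : upd (upd s x false) x true = upd s x true.
  by apply/funext => y; rewrite /upd; case: eqP.
by lra.
Qed.

End gibbs.

(** * The magnetization is carried by the cluster of the boundary *)

Definition plus (sigma : config) (c : Z2) : bool :=
  sigma (c, ord0) && sigma (c, ord_max).

Definition bdry (B : {fset Z2}) (d : Z2) : bool :=
  (d \in B) && `[< exists2 e, adj_Z2 d e & e \notin B >].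

Definition escapes (B : {fset Z2}) (sigma : config) (c : Z2) : bool :=
  `[< exists2 d, bdry B d &
      conn adj_Z2 (fun z => (z \in B) && plus sigma z) c d >].

Definition other (i : 'I_2) : 'I_2 := if i == ord0 then ord_max else ord0.

Lemma otherK : involutive other.
Proof. by move=> i; apply: val_inj; case: i => [[|[|//]]]. Qed.

Lemma I2P (i : 'I_2) : i = ord0 \/ i = ord_max.
Proof. by case: i => [[|[|//]] ?]; [left|right]; apply: val_inj. Qed.

Lemma mem_slab_over (B : {fset Z2}) (x : slab) : (x \in slab_over B) = (x.1 \in B).
Proof.
rewrite /slab_over in_fsetM; apply: andb_idr => _.
by apply/imfsetP; exists x.2.
Qed.

Lemma adj_slab_columns (x y : slab) : adj_slab x y -> x.1 = y.1 \/ adj_Z2 x.1 y.1.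
Proof.
rewrite /adj_slab /adj_Z2 /dist2 => /eqP H.
have := sqr_ge0 (x.1.1 - y.1.1); have := sqr_ge0 (x.1.2 - y.1.2).
have := sqr_ge0 (x.2%:Z - y.2%:Z) => h3 h2 h1.
have : (x.1.1 - y.1.1) ^+ 2 + (x.1.2 - y.1.2) ^+ 2 = 0 \/
  (x.1.1 - y.1.1) ^+ 2 + (x.1.2 - y.1.2) ^+ 2 = 1 by lia.
case=> [E|->]; last by right.
left; rewrite (surjective_pairing x.1) (surjective_pairing y.1).
by move/eqP: E; rewrite paddr_eq0// !sqrf_eq0 !subr_eq0 => /andP[/eqP -> /eqP ->].
Qed.

Lemma escapes_plus B sigma c : escapes B sigma c -> plus sigma c.
Proof. by move=> /asboolP[d _ /conn_endl/andP[]]. Qed.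

Lemma escapes_in B sigma c : escapes B sigma c -> c \in B.
Proof. by move=> /asboolP[d _ /conn_endl/andP[]]. Qed.

Lemma escapes_bdry B sigma c : bdry B c -> plus sigma c -> escapes B sigma c.
Proof.
move=> cB cp; apply/asboolP; exists c => //; apply: conn_refl.
by rewrite cp andbT; case/andP: cB.
Qed.

Lemma escapes_adj B sigma c d : adj_Z2 c d -> c \in B -> plus sigma c ->
  escapes B sigma d -> escapes B sigma c.
Proof.
move=> cd cB cp /asboolP[e eB de]; apply/asboolP; exists e => //.
apply: (conn_trans _ de); apply: conn_adj => //; first by rewrite cB.
exact: conn_endl de.
Qed.

Section exploration.
Variables (B k : {fset Z2}).

Definition revealed (sigma : config) : {fset Z2} := [fset c in B | escapes B sigma c]%fset.

Definition rim : {fset Z2} := [fset c in B | (c \notin k) &&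
  (bdry B c || `[< exists2 d, d \in k & adj_Z2 c d >])]%fset.

Definition unexplored : {fset Z2} := (B `\` (k `|` rim))%fset.

Lemma revealedE sigma c : (c \in revealed sigma) = escapes B sigma c.
Proof. by rewrite !inE; apply: andb_idl; exact: escapes_in. Qed.

Lemma rimP c : reflect [/\ c \in B, c \notin k & bdry B c \/ exists2 d, d \in k & adj_Z2 c d]
  (c \in rim).
Proof.
rewrite !inE; apply: (iffP and3P) => -[cB ck H]; split => //.
  by case/orP: H => [|/asboolP]; [left|right].
by apply/orP; case: H => [|/asboolP]; [left|right].
Qed.

Lemma rim_nonplus sigma c : revealed sigma = k -> c \in rim -> ~~ plus sigma c.
Proof.
move=> Kk /rimP[cB ck H]; apply: contra ck => cp; rewrite -Kk revealedE.
case: H => [cb|[d dk cd]]; first exact: escapes_bdry.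
by apply: escapes_adj cd cB cp _; rewrite -revealedE Kk.
Qed.

(** The event that the revealed cluster is [k] is decided by the columns of [k]
and of its rim, so it leaves the unexplored spins free. *)
Lemma revealed_off sigma tau : (forall c, c \in k \/ c \in rim -> plus sigma c = plus tau c) ->
  revealed sigma = k -> revealed tau = k.
Proof.
move=> st Kk.
have rimN c : c \in rim -> ~~ plus tau c.
  by move=> cr; rewrite -st; [exact: rim_nonplus|right].
apply/fsetP => c; rewrite revealedE; apply/idP/idP => [/asboolP[d dB cd]|].
  have := conn_sym adj_Z2_sym cd => dc.
  pattern c; apply: (conn_ind dc) => [/andP[dinB dp]|y z _ yk yz /andP[zB zp]].
    apply: contraTT dp => dk; apply: rimN; apply/rimP; split => //; by left.
  apply: contraTT zp => zk; apply: rimN; apply/rimP; split => //; right.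
  by exists y => //; rewrite adj_Z2_sym.
rewrite -[in X in X -> _]Kk revealedE => /asboolP[d dB cd]; apply/asboolP; exists d => //.
apply: (conn_sym adj_Z2_sym).
have dc := conn_sym adj_Z2_sym cd.
have inK z : conn adj_Z2 (fun z => (z \in B) && plus sigma z) d z -> plus tau z.
  move=> dz; rewrite -st; first by have /andP[] := conn_endr dz.
  left; rewrite -Kk revealedE; apply/asboolP; exists d => //.
  exact: (conn_sym adj_Z2_sym).
pattern c; apply: (conn_ind dc) => [dp|y z dy IH yz zp].
  by apply: conn_refl; rewrite inK ?andbT; [case/andP: dp|exact: conn_refl].
apply: (conn_trans IH); apply: conn_adj => //; first exact: conn_endr IH.
rewrite inK ?andbT; first by case/andP: zp.
by apply: (conn_trans dy); apply: conn_adj => //; exact: conn_endr dy.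
Qed.

End exploration.

Section boundary_cluster.
Context {R : realType}.
Variable beta : R.
Hypothesis beta_ge0 : 0 <= beta.

Definition column_magnetization (c : Z2) (sigma : config) : R :=
  spin (sigma (c, ord0)) + spin (sigma (c, ord_max)).

Local Notation mag := column_magnetization.

Lemma mag_local (c : Z2) (L : {fset Z2}) : c \in L -> local_on (slab_over L) (mag c).
Proof. by move=> cL s t st; rewrite /mag !st ?mem_slab_over. Qed.

(** Flipping all spins and exchanging the layers raises the columns that are
not [++] and reverses the magnetization. *)
Lemma gibbs_nonplus_bc (L : {fset Z2}) (c : Z2) (eta : config) : c \in L ->
  (forall a b, a \in L -> b \notin L -> adj_Z2 a b -> ~~ plus eta b) ->
  gibbs beta (slab_over L) eta (mag c) <= 0.
Proof.
move=> cL H.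
pose N (b : Z2) := `[< exists2 a, a \in L & adj_Z2 a b >] && (b \notin L).
pose flip (x : slab) : slab := (x.1, other x.2).
have flipK : cancel flip flip by move=> [x i]; rewrite /flip /= otherK.
have flip_adj x y : adj_slab (flip x) (flip y) = adj_slab x y.
  rewrite /adj_slab /flip /=; congr (_ + _ == _).
  by case: (I2P x.2) => ->; case: (I2P y.2) => ->; rewrite /other /=.
have flipL x : (flip x \in slab_over L) = (x \in slab_over L).
  by rewrite !mem_slab_over.
pose eta1 : config := fun x => N x.1 && eta x.
pose eta2 : config := (negb \o eta1) \o flip.
have eta12 : cle eta1 eta2.
  move=> [b i]; rewrite /eta2 /eta1 /= => /andP[Nb etab]; rewrite Nb /=.
  have /andP[/asboolP[a aL ab] bL] := Nb.
  have := H _ _ aL bL ab; rewrite /plus.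
  by case: (I2P i) etab => ->; rewrite /other /= => ->; rewrite ?andbT.
have -> : gibbs beta (slab_over L) eta (mag c) = gibbs beta (slab_over L) eta1 (mag c).
  apply: gibbs_bc; first exact: mag_local.
  move=> x y; rewrite !mem_slab_over /eta1 => xL yL.
  case/adj_slab_columns => [xy|xy]; first by rewrite -xy xL in yL.
  by rewrite /N yL andbT; have -> // : `[< exists2 a, a \in L & adj_Z2 a y.1 >];
    apply/asboolP; exists x.1.
have mag_flip s : mag c ((negb \o s) \o flip) = - mag c s.
  by rewrite /mag /= /flip /= /other /= /spin; case: (s _); case: (s _) => /=; lra.
have E : gibbs beta (slab_over L) eta2 (mag c) = - gibbs beta (slab_over L) eta1 (mag c).
  rewrite /eta2 -(gibbs_comp beta (M := slab_over L) _ _ flipK flipK flip_adj flipL).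
  rewrite -gibbs_neg -mulN1r -gibbsZ; apply: eq_gibbs => s _.
  by rewrite mulN1r -mag_flip.
have mono : gibbs beta (slab_over L) eta1 (fun s => mag c s + 2) <=
            gibbs beta (slab_over L) eta2 (fun s => mag c s + 2).
  apply: gibbs_mono => // s; first by rewrite /mag /spin; do 2 case: (s _); lra.
  move=> t st; rewrite lerD2r; apply: lerD; rewrite /spin.
    by have [/st ->//|_] := boolP (s _); case: (t _); lra.
  by have [/st ->//|_] := boolP (s _); case: (t _); lra.
have {}mono : gibbs beta (slab_over L) eta1 (mag c) + 2 <=
              gibbs beta (slab_over L) eta2 (mag c) + 2.
  by move: mono; rewrite !gibbsD !gibbs_cst.
by rewrite E in mono; lra.
Qed.

(** Reveal the cluster of the boundary of [B]. The unrevealed part is surrounded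
by columns that are not [++], so its magnetization is at most 0. *)
Lemma gibbs_not_escapes (B : {fset Z2}) (c : Z2) (eta : config) : c \in B ->
  gibbs beta (slab_over B) eta
    (fun s => mag c s * (~~ escapes B s c)%:R) <= 0.
Proof.
move=> cB.
have -> : gibbs beta (slab_over B) eta (fun s => mag c s * (~~ escapes B s c)%:R) =
    gibbs beta (slab_over B) eta (fun s => \sum_(k <- fpowerset B | c \notin k)
      (revealed B s == k)%:R * mag c s).
  apply: eq_gibbs => s _; rewrite -mulr_suml mulrC; congr (_ * _).
  have KB : revealed B s \in fpowerset B.
    by rewrite fpowersetE; apply/fsubsetP => x; rewrite inE => /andP[].
  rewrite -revealedE big_mkcond (bigD1_seq _ KB)/= ?fset_uniq// eqxx big1 ?addr0.
    by case: ifP.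
  by move=> k kK; case: ifP => // _; rewrite eq_sym (negbTE kK).
rewrite gibbs_sum big_seq_cond; apply: sumr_le0 => k /andP[kB ck].
have [crim|crim] := boolP (c \in rim B k).
  rewrite -(gibbs_cst beta (slab_over B) eta 0); apply: ler_gibbs => s _.
  have [Kk|_] := eqVneq; last by rewrite mul0r.
  rewrite mul1r; have := rim_nonplus Kk crim.
  by rewrite /plus /mag /spin; do 2 case: (s _); lra.
set L := unexplored B k.
have cL : c \in L by rewrite !in_fsetD in_fsetU negb_or ck crim cB.
rewrite (@gibbs_tower _ _ (slab_over L)).
- rewrite -(gibbs_cst beta (slab_over B) eta 0); apply: ler_gibbs => s _.
  have [Kk|_] := eqVneq; last by rewrite mul0r.
  rewrite mul1r; apply: gibbs_nonplus_bc => // a b aL bL ab.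
  apply: (rim_nonplus Kk); move: aL bL; rewrite !in_fsetD !in_fsetU !negb_or.
  move=> /andP[/andP[ak arim] aB] H.
  have bB : b \in B.
    apply: contraNT arim => bB; apply/rimP; split => //; left.
    by rewrite /bdry aB; apply/asboolP; exists b.
  have bk : b \notin k.
    by apply: contraNN arim => bk; apply/rimP; split => //; right; exists b.
  by move: H; rewrite bB bk andbT negbK.
- by apply/fsubsetP => x; rewrite !mem_slab_over !in_fsetD => /andP[].
- move=> s t st; congr (_%:R).
  have E d : d \in k \/ d \in rim B k -> plus s d = plus t d.
    move=> H; rewrite /plus !st// mem_slab_over in_fsetD in_fsetU;
      by case: H => ->; rewrite ?orbT.
  suff -> : (revealed B t == k) = (revealed B s == k) by [].
  by apply/eqP/eqP; apply: revealed_off => d H; rewrite E.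
Qed.

Lemma gibbs_magnetization_le (B : {fset Z2}) (c : Z2) (eta : config) : c \in B ->
  gibbs beta (slab_over B) eta (mag c) <=
  2 * gibbs beta (slab_over B) eta (fun s => (escapes B s c)%:R).
Proof.
move=> cB; have H := gibbs_not_escapes eta cB.
have -> : gibbs beta (slab_over B) eta (mag c) =
    gibbs beta (slab_over B) eta (fun s => mag c s * (~~ escapes B s c)%:R) +
    gibbs beta (slab_over B) eta (fun s => mag c s * (escapes B s c)%:R).
  rewrite -gibbsD; apply: eq_gibbs => s _.
  by case: (escapes B s c); rewrite /= mulr1 mulr0 ?addr0 ?add0r.
have : gibbs beta (slab_over B) eta (fun s => mag c s * (escapes B s c)%:R) <=
    2 * gibbs beta (slab_over B) eta (fun s => (escapes B s c)%:R).
  rewrite -gibbsZ; apply: ler_gibbs => s _; rewrite ler_wpM2r//.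
  by rewrite /mag /spin; do 2 case: (s _); lra.
by lra.
Qed.

End boundary_cluster.

(** * The infinite-volume probability of local events *)

Lemma near_boxes (B0 : {fset Z2}) : \forall B \near boxes, (B0 `<=` B)%fset.
Proof. by exists B0 => // B []. Qed.

Lemma cvg_le_limit (R : realType) (f g : {fset Z2} -> R) (a b : R) :
  f B @[B --> boxes] --> a -> g B @[B --> boxes] --> b ->
  (\forall B \near boxes, f B <= g B) -> a <= b.
Proof.
move=> /cvgrPdist_lt fa /cvgrPdist_lt gb fg; rewrite leNgt; apply/negP => ba.
have e0 : 0 < (a - b) / 2 by rewrite divr_gt0// subr_gt0.
have [B [[]]] := filter_ex (filterI (filterI (fa _ e0) (gb _ e0)) fg).
by rewrite !ltr_distl => /andP[? ?] /andP[? ?] ?; lra.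
Qed.

Lemma cvg_limit_unique (R : realType) (f : {fset Z2} -> R) (a b : R) :
  f B @[B --> boxes] --> a -> f B @[B --> boxes] --> b -> a = b.
Proof.
move=> fa fb; apply/eqP; rewrite eq_le; apply/andP; split.
  by apply: (cvg_le_limit fa fb); apply: nearW => B.
by apply: (cvg_le_limit fb fa); apply: nearW => B.
Qed.

(** ** Local events *)

Definition event := config -> bool.

Definition local_event (A : event) := exists L : {fset slab}, local_on L A.

Definition increasing_event (A : event) := forall s t, cle s t -> A s -> A t.

Lemma local_op (op : bool -> bool -> bool) (A B : event) :
  local_event A -> local_event B -> local_event (fun s => op (A s) (B s)).
Proof.
move=> [L AL] [M BM]; exists (L `|` M)%fset => s t st.
by rewrite (AL s t) ?(BM s t)// => x xL; apply: st; rewrite inE xL ?orbT.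
Qed.

Lemma localI (A B : event) :
  local_event A -> local_event B -> local_event (fun s => A s && B s).
Proof. exact: local_op. Qed.

Lemma localU (A B : event) :
  local_event A -> local_event B -> local_event (fun s => A s || B s).
Proof. exact: local_op. Qed.

Lemma localC (A : event) : local_event A -> local_event (fun s => ~~ A s).
Proof. by move=> [L AL]; exists L => s t st; rewrite (AL s t). Qed.

Lemma local_cst b : local_event (fun=> b). Proof. by exists fset0. Qed.

Lemma local_spin x : local_event (fun s => s x).
Proof. by exists [fset x]%fset => s t; apply; rewrite inE. Qed.

Lemma local_all (I : Type) (r : seq I) (A : I -> event) :
  (forall i, local_event (A i)) -> local_event (fun s => all (fun i => A i s) r).
Proof.
by move=> H; elim: r => [|i r IH] /=; [exact: local_cst|exact: localI].
Qed.

Lemma local_has (I : Type) (r : seq I) (A : I -> event) :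
  (forall i, local_event (A i)) -> local_event (fun s => has (fun i => A i s) r).
Proof.
by move=> H; elim: r => [|i r IH] /=; [exact: local_cst|exact: localU].
Qed.

Lemma local_neg (A : event) : local_event A -> local_event (fun s => A (negb \o s)).
Proof. by move=> [L AL]; exists L => s t st; apply: AL => x /st /= ->. Qed.

Lemma local_comp (f g : slab -> slab) (A : event) : cancel g f ->
  local_event A -> local_event (fun s => A (s \o f)).
Proof.
move=> gK [L AL]; exists [fset f x | x in L]%fset => s t st; apply: AL => x xL /=.
by apply: st; apply/imfsetP; exists x.
Qed.

Section infinite_volume.
Context {R : realType}.
Variable beta : R.
Hypothesis beta_ge0 : 0 <= beta.

Definition fv (b : bool) (B : {fset Z2}) (A : event) : R :=
  gibbs beta (slab_over B) (fun=> b) (fun s => (A s)%:R).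

Variable P : event -> R.
Hypothesis P_lim : forall A, local_event A -> fv true B A @[B --> boxes] --> P A.

Lemma le_fv b B (A A' : event) : (forall s, A s -> A' s) -> fv b B A <= fv b B A'.
Proof.
move=> AA'; apply: ler_gibbs => s _; have := AA' s.
by case: (A s); case: (A' s) => // /(_ isT).
Qed.

Lemma fvC b B (A : event) : fv b B (fun s => ~~ A s) = 1 - fv b B A.
Proof.
rewrite -(gibbs_cst beta (slab_over B) (fun=> b) 1) -gibbsB; apply: eq_gibbs => s _.
by case: (A s); rewrite ?subrr ?subr0.
Qed.

Lemma eq_P (A A' : event) : (forall s, A s = A' s) -> P A = P A'.
Proof. by move=> H; congr P; apply/funext. Qed.

Lemma le_P (A A' : event) : local_event A -> local_event A' ->
  (forall s, A s -> A' s) -> P A <= P A'.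
Proof.
move=> lA lA' AA'; apply: (cvg_le_limit (P_lim lA) (P_lim lA')).
by apply: nearW => B; exact: le_fv.
Qed.

Lemma P_cst b : P (fun=> b) = b%:R.
Proof.
apply: (cvg_limit_unique (P_lim (local_cst b))).
rewrite (_ : (fun B => _) = cst (b%:R : R)); first exact: cvg_cst.
by apply/funext => B; exact: gibbs_cst.
Qed.

Lemma P_ge0 (A : event) : local_event A -> 0 <= P A.
Proof. by move=> lA; rewrite -[0](P_cst false); apply: le_P => //; exact: local_cst. Qed.

Lemma P_sum_le (I : eqType) (r : seq I) (A : I -> event) (c : R) :
  (forall i, i \in r -> local_event (A i)) ->
  (forall s, \sum_(i <- r) (A i s)%:R <= c) -> \sum_(i <- r) P (A i) <= c.
Proof.
move=> lA H.
have C : (\sum_(i <- r) fv true B (A i)) @[B --> boxes] --> \sum_(i <- r) P (A i).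
  elim: r lA {H} => [|i r IH] lA.
    by under eq_fun do rewrite big_nil; rewrite big_nil; exact: cvg_cst.
  under eq_fun do rewrite big_cons; rewrite big_cons; apply: cvgD.
    by apply: P_lim; apply: lA; exact: mem_head.
  by apply: IH => j jr; apply: lA; rewrite inE jr orbT.
apply: (cvg_le_limit C (cvg_cst c)); apply: nearW => B.
rewrite -gibbs_sum -(gibbs_cst beta (slab_over B) (fun=> true) c).
by apply: ler_gibbs => s _; exact: H.
Qed.

Lemma P_add (A A1 A2 : event) : local_event A1 -> local_event A2 -> local_event A ->
  (forall s, (A s)%:R = (A1 s)%:R + (A2 s)%:R :> R) -> P A = P A1 + P A2.
Proof.
move=> l1 l2 l H; apply: (cvg_limit_unique (P_lim l)).
rewrite (_ : (fun B => _) = fun B => fv true B A1 + fv true B A2).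
  exact: cvgD (P_lim l1) (P_lim l2).
by apply/funext => B; rewrite /fv -gibbsD; apply: eq_gibbs => s _.
Qed.

Lemma P_C (A : event) : local_event A -> P (fun s => ~~ A s) = 1 - P A.
Proof.
move=> lA; rewrite -[1](P_cst true) (@P_add (fun=> true) A (fun s => ~~ A s))//.
- by rewrite addrAC subrr add0r.
- exact: localC.
- exact: local_cst.
- by move=> s; case: (A s); rewrite ?addr0 ?add0r.
Qed.

Lemma P_split (A C : event) : local_event A -> local_event C ->
  P A = P (fun s => A s && C s) + P (fun s => A s && ~~ C s).
Proof.
move=> lA lC; apply: P_add => //; first exact: localI.
  by apply: localI => //; exact: localC.
by move=> s; case: (A s); case: (C s); rewrite ?addr0 ?add0r.
Qed.

Lemma P_fkg (A A' : event) : local_event A -> local_event A' ->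
  increasing_event A -> increasing_event A' -> P A * P A' <= P (fun s => A s && A' s).
Proof.
move=> lA lA' iA iA'.
apply: (cvg_le_limit (cvgM (P_lim lA) (P_lim lA')) (P_lim (localI lA lA'))).
have incr (C : event) : increasing_event C -> spin_increasing (fun s => (C s)%:R : R).
  by move=> iC s t /iC; case: (C s); case: (C t) => // /(_ isT).
apply: nearW => B; apply: le_trans (gibbs_fkg beta_ge0 _ _ _ _ _ _) _ => //.
- exact: incr.
- exact: incr.
by apply: ler_gibbs => s _; case: (A s); case: (A' s); rewrite /= ?mulr1 ?mulr0 ?mul0r.
Qed.

(** FKG applied to one event and the union of the others. Used as the square-root
trick: if the union is likely, then so is one of the events. *)
Lemma P_fkg_none (I : Type) (r : seq I) (A : I -> event) :
  (forall i, local_event (A i)) -> (forall i, increasing_event (A i)) ->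
  \prod_(i <- r) (1 - P (A i)) <= 1 - P (fun s => has (fun i => A i s) r).
Proof.
move=> lA iA; elim: r => [|i r IH].
  by rewrite big_nil P_cst subr0.
rewrite big_cons; have lh := local_has r lA.
have ih : increasing_event (fun s => has (fun i => A i s) r).
  by move=> s t st; apply: sub_has => j; exact: iA.
have Ai1 : P (A i) <= 1 by rewrite -[1](P_cst true); apply: le_P => //; exact: local_cst.
apply: (le_trans (y := (1 - P (A i)) * (1 - P (fun s => has (fun i => A i s) r)))).
  by rewrite ler_wpM2l// subr_ge0.
have := P_fkg (lA i) lh (iA i) ih.
have := P_split (localU (lA i) lh) (lA i).
rewrite (@eq_P (fun s => (A i s || _) && A i s) (A i)); last first.
  by move=> s; case: (A i s); rewrite ?andbT ?andbF.
rewrite (@eq_P (fun s => (A i s || _) && ~~ A i s)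
   (fun s => has (fun i => A i s) r && ~~ A i s)); last first.
  by move=> s; case: (A i s); rewrite ?andbT ?andbF.
have := P_split lh (lA i).
rewrite (@eq_P (fun s => has (fun i => A i s) r && A i s)
   (fun s => A i s && has (fun i => A i s) r)); last by move=> s; rewrite andbC.
by rewrite /=; move=> H1 H2 H3; lra.
Qed.

Lemma P_union (I : eqType) (r : seq I) (A : I -> event) :
  (forall i, local_event (A i)) ->
  P (fun s => has (fun i => A i s) r) <= \sum_(i <- r) P (A i).
Proof.
move=> lA; elim: r => [|i r IH]; first by rewrite big_nil P_cst.
rewrite big_cons; have lh := local_has r lA.
rewrite (P_split (local_has (i :: r) lA) (lA i)); apply: lerD.
  by apply: le_P => //; [apply: localI => //; exact: (local_has (i :: r) lA)|move=> s /andP[]].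
apply: le_trans IH; apply: le_P => //.
  by apply: localI; [exact: (local_has (i :: r) lA)|exact: localC].
by move=> s /= /andP[/orP[->|->]].
Qed.

(** ** Symmetries *)

Definition column_map (f : Z2 -> Z2) (x : slab) : slab := (f x.1, x.2).

(** Such a map sends the filter of boxes to itself, so both sides are limits of the
same net. *)
Lemma P_sym (f g : Z2 -> Z2) (A : event) : cancel f g -> cancel g f ->
  (forall c d, dist2 (f c) (f d) = dist2 c d) ->
  (forall B : {fset Z2}, is_box B -> is_box [fset g c | c in B]%fset) ->
  local_event A -> P (fun s => A (s \o column_map f)) = P A.
Proof.
move=> fK gK fd fbox lA.
have fK' : cancel (column_map f) (column_map g) by move=> [c i]; rewrite /column_map /= fK.
have gK' : cancel (column_map g) (column_map f) by move=> [c i]; rewrite /column_map /= gK.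
apply: (cvg_limit_unique (P_lim (local_comp gK' lA))).
have -> : (fun B => fv true B (fun s => A (s \o column_map f))) =
    (fun B => fv true B A) \o (fun B : {fset Z2} => [fset g c | c in B]%fset).
  apply/funext => B; rewrite /fv /=.
  rewrite (@gibbs_comp _ beta (column_map f) (column_map g)
    (slab_over [fset g c | c in B]%fset) (slab_over B) _ (fun s => (A s)%:R))//.
    by move=> x y; rewrite /adj_slab /column_map /= fd.
  move=> x; rewrite !mem_slab_over /=; apply/idP/imfsetP => [fxB|[c cB ->]].
    by exists (f x.1) => //; rewrite fK.
  by rewrite gK.
apply: cvg_comp (P_lim lA) => U [B0 _ B0U].
exists [fset f c | c in B0]%fset => // B [boxB B0B]; apply: B0U; split; first exact: fbox.
apply/fsubsetP => c cB0; apply/imfsetP; exists (f c); last by rewrite fK.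
by apply: (fsubsetP B0B); apply/imfsetP; exists c.
Qed.

Lemma P_swap (A : event) : local_event A ->
  P (fun s => A (s \o (fun x => (x.1, other x.2)))) = P A.
Proof.
pose flip (x : slab) : slab := (x.1, other x.2).
have flipK : cancel flip flip by move=> [x i]; rewrite /flip /= otherK.
move=> lA; apply: (cvg_limit_unique (P_lim (local_comp flipK lA))).
have -> : (fun B => fv true B (fun s => A (s \o flip))) = (fun B => fv true B A).
  apply/funext => B; rewrite /fv.
  rewrite (@gibbs_comp _ beta flip flip (slab_over B) (slab_over B) _ (fun s => (A s)%:R))//.
    move=> x y; rewrite /adj_slab /flip /=; congr (_ + _ == _).
    by case: (I2P x.2) => ->; case: (I2P y.2) => ->; rewrite /other /=.
  by move=> x; rewrite !mem_slab_over.
exact: P_lim.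
Qed.

(** ** Finite energy *)

Lemma P_force (r : seq slab) : uniq r -> exists2 c : R, 0 < c & forall A : event,
  local_event A -> off [fset x in r]%fset A ->
  c * P A <= P (fun s => A s && all s r).
Proof.
elim: r => [_|x r IHr /= /andP[xr /IHr[c c0 IH]]].
  exists 1 => // A lA _; rewrite mul1r (@eq_P (fun s => A s && true) A)// => s.
  by rewrite andbT.
have [d d0 H] := gibbs_force beta_ge0 x.
exists (c * d); first by rewrite mulr_gt0.
move=> A lA oA.
have lax : local_event (fun s => A s && s x) by apply: localI => //; exact: local_spin.
have lar : local_event (fun s => A s && all s r).
  by apply: localI => //; apply: (local_all r (A := fun x s => s x)); exact: local_spin.
have la : local_event (fun s => A s && (s x && all s r)).
  by apply: localI => //; apply: (local_all (x :: r) (A := fun x s => s x)); exact: local_spin.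
have oAr : off [fset y in r]%fset A.
  move=> s t st; apply: oA => y; rewrite !inE negb_or => /andP[_ yr].
  by apply: st; rewrite inE.
rewrite (mulrC c) -mulrA.
apply: (le_trans (y := d * P (fun s => A s && all s r))).
  by rewrite ler_pM2l// IH.
have C := @cvgMl_tmp _ _ _ boxes_filter _ d _ (P_lim lar).
apply: (cvg_le_limit C (P_lim la)).
have := near_boxes [fset x.1]%fset; apply: filterS => B; rewrite fsub1set => xB.
apply: le_trans (H _ _ _ _ _ _) _.
- by rewrite mem_slab_over.
- by [].
- move=> s t st; congr (_%:R); congr (nat_of_bool (_ && _)).
    by apply: oA => y; rewrite !inE negb_or => /andP[yx _]; apply: st; rewrite inE.
  apply: eq_in_all => y yr; apply: st; rewrite inE.
  by apply: contraNneq xr => <-.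
- apply: ler_gibbs => s _.
  by case: (s x); case: (A s); case: (all s r); rewrite /= ?mulr1 ?mulr0 ?mul0r.
Qed.

End infinite_volume.

Lemma box_translate (t : Z2) (B : {fset Z2}) : is_box B ->
  is_box [fset (c.1 - t.1, c.2 - t.2) | c in B]%fset.
Proof.
move=> [a [b [c [d H]]]]; exists (a - t.1), (b - t.1), (c - t.2), (d - t.2) => i j.
have -> : (i, j) \in [fset (c.1 - t.1, c.2 - t.2) | c in B]%fset =
    ((i + t.1, j + t.2) \in B).
  apply/imfsetP/idP => [[[x y] /= xyB [-> ->]]|ijB].
    by rewrite !subrK.
  by exists (i + t.1, j + t.2) => //=; rewrite !addrK.
rewrite H; lia.
Qed.

(** * Consequences of the value of the magnetization *)

Section magnetization_bounds.
Context {R : realType}.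
Variable beta : R.
Hypothesis beta_ge0 : 0 <= beta.
Variable P : event -> R.
Hypothesis P_lim : forall A, local_event A -> fv beta true B A @[B --> boxes] --> P A.

Local Notation fv := (fv beta).

(** Cut the escape from the larger set at its first exit from the smaller one. *)
Lemma escapes_sub (B B' : {fset Z2}) s c : (B' `<=` B)%fset -> c \in B' ->
  escapes B s c -> escapes B' s c.
Proof.
move=> B'B cB' /asboolP[d /andP[dB /asboolP[e de eB]] cd].
have [|||a [b [ca ab bU bB']]] :=
    @conn_exit _ adj_Z2 (fun z => (z \in B) && plus s z || (z == e)) (mem B') c e.
- apply: (@conn_trans _ _ _ _ d).
    by apply: conn_sub cd => z ->.
  by apply: conn_adj; [exact: de|rewrite (conn_endr cd)|rewrite eqxx orbT].
- exact: cB'.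
- by apply: contra eB; exact: (fsubsetP B'B).
have sub z : (predI (fun z => (z \in B) && plus s z || (z == e)) (mem B')) z ->
    (z \in B') && plus s z.
  move=> /andP[/= /orP[/andP[_ ->] ->//|/eqP -> eB']].
  by rewrite (fsubsetP B'B _ eB') in eB.
have ca' := conn_sub sub ca.
apply/asboolP; exists a => //; have /andP[aB' _] := conn_endr ca'.
by rewrite /bdry aB'; apply/asboolP; exists b.
Qed.

Lemma escapes_local B c : local_on (slab_over B) (escapes B ^~ c).
Proof.
move=> s t st.
suff E z : (z \in B) && plus s z = (z \in B) && plus t z.
  by congr asbool; apply/propext; split => -[d dB cd]; exists d => //;
    apply: conn_sub cd => z; rewrite E.
by have [zB|//] := boolP (z \in B); rewrite /plus !st ?mem_slab_over.
Qed.

Lemma escapes_increasing B c : increasing_event (escapes B ^~ c).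
Proof.
move=> s t st /asboolP[d dB cd]; apply/asboolP; exists d => //.
apply: conn_sub cd => z /andP[-> /andP[/st z0 /st z1]].
by rewrite /plus z0.
Qed.

Definition up (x : slab) : event := fun s => s x.

Definition spin_prob : R := P (up (origin, ord0)).

Definition shift (t : Z2) (s : config) : config :=
  s \o column_map (fun c => (c.1 + t.1, c.2 + t.2)).

Lemma shift_local (t : Z2) (A : event) :
  local_event A -> local_event (fun s => A (shift t s)).
Proof.
apply: (local_comp (g := column_map (fun c => (c.1 - t.1, c.2 - t.2)))).
by move=> [[x y] i]; rewrite /column_map /= !subrK.
Qed.

Lemma P_shift (t : Z2) (A : event) : local_event A -> P (fun s => A (shift t s)) = P A.
Proof.
move=> lA; apply: (P_sym P_lim (g := fun c => (c.1 - t.1, c.2 - t.2))) => //.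
- by move=> [x y] /=; rewrite !addrK.
- by move=> [x y] /=; rewrite !subrK.
- by move=> c d; rewrite /dist2 /=; congr (_ ^+ 2 + _ ^+ 2); ring.
- exact: box_translate.
Qed.

Lemma spin_probE x : P (up x) = spin_prob.
Proof.
case: x => c i; have -> : P (up (c, i)) = P (up (c, ord0)).
  case: (I2P i) => -> //; rewrite -(P_swap P_lim (local_spin (c, ord0))).
  by apply: eq_P => s.
rewrite /spin_prob -(P_shift c (local_spin (origin, ord0))); apply: eq_P => s.
by rewrite /up /shift /= /column_map /= !add0r -surjective_pairing.
Qed.

Lemma fv_le_sign B (A : event) : increasing_event A -> fv false B A <= fv true B A.
Proof.
move=> iA; apply: gibbs_mono => //.
by move=> s t /iA; case: (A s); case: (A t) => // /(_ isT).
Qed.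

Lemma fv_neg b B (A : event) : fv b B (fun s => A (negb \o s)) = fv (~~ b) B A.
Proof. exact: (gibbs_neg beta (slab_over B) (fun=> b) (fun s => (A s)%:R)). Qed.

Lemma fv_up_false B x : fv false B (up x) = 1 - fv true B (up x).
Proof. by rewrite -[false]/(~~ true) -fv_neg -fvC. Qed.

Lemma spin_prob_ge : 1 <= 2 * spin_prob.
Proof.
have C : (2 * fv true B (up (origin, ord0))) @[B --> boxes] --> 2 * spin_prob.
  exact: (@cvgMl_tmp _ _ _ boxes_filter _ 2 _ (P_lim (local_spin (origin, ord0)))).
have C1 : (1 : R) @[_ --> boxes] --> (1 : R) by exact: cvg_cst.
apply: (cvg_le_limit C1 C); apply: nearW => B.
have : fv false B (up (origin, ord0)) <= fv true B (up (origin, ord0)).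
  by apply: fv_le_sign => s t; apply.
by rewrite fv_up_false /up; lra.
Qed.

Lemma spin_prob_le_escapes (B : {fset Z2}) : origin \in B ->
  2 * spin_prob - 1 <= P (escapes B ^~ origin).
Proof.
move=> oB.
have lE : local_event (escapes B ^~ origin) by exists (slab_over B); exact: escapes_local.
have C0 := P_lim (local_spin (origin, ord0)).
have C1 := P_lim (local_spin (origin, ord_max)).
have C2 : (1 : R) @[_ --> boxes] --> (1 : R) by exact: cvg_cst.
have C : (fv true B (up (origin, ord0)) + fv true B (up (origin, ord_max)) - 1)
    @[B --> boxes] --> P (up (origin, ord0)) + P (up (origin, ord_max)) - 1.
  exact: (cvgB (cvgD C0 C1) C2).
have -> : 2 * spin_prob - 1 = P (up (origin, ord0)) + P (up (origin, ord_max)) - 1.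
  by rewrite !spin_probE; ring.
apply: (cvg_le_limit C (P_lim lE)).
have := near_boxes B; apply: filterS => B' BB'.
have oB' : origin \in B' := fsubsetP BB' _ oB.
have := gibbs_magnetization_le beta_ge0 (fun=> true) oB'.
have -> : gibbs beta (slab_over B') (fun=> true) (column_magnetization origin) =
   2 * (fv true B' (up (origin, ord0)) + fv true B' (up (origin, ord_max))) - 2.
  rewrite /fv -gibbsD -gibbsZ -[X in _ - X](gibbs_cst beta (slab_over B') (fun=> true)) -gibbsB.
  apply: eq_gibbs => s _; rewrite /column_magnetization /spin /up.
  by case: (s (_, ord0)); case: (s (_, ord_max)); rewrite /=; ring.
have : fv true B' (escapes B' ^~ origin) <= fv true B' (escapes B ^~ origin).
  by apply: le_fv => s; exact: escapes_sub.
by rewrite /fv /up; set a := gibbs _ _ _ _ ; set b := gibbs _ _ _ _; move: a b => a b; simpl; lra.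
Qed.

Section vanishing_magnetization.
Hypothesis M0 : 2 * spin_prob = 1.

(** The sum of the spins over the support of [A] increases at least as much as
[A] when spins are raised, so it controls the influence of the boundary. *)
Lemma fv_sign_diff (L : {fset slab}) B (A : event) : local_on L A ->
  `|fv true B A - fv false B A| <=
  \sum_(x <- L) (fv true B (up x) - fv false B (up x)).
Proof.
move=> AL.
pose S (s : config) : R := \sum_(x <- L) (s x)%:R.
have S0 s : 0 <= S s by apply: sumr_ge0.
have Si s t : cle s t -> S s + `|(A t)%:R - (A s)%:R| <= S t.
  move=> st; have le1 x : (s x)%:R <= (t x)%:R :> R.
    by have := st x; case: (s x); case: (t x) => // /(_ isT).
  have [[x xL xst]|H] := pselect (exists2 x, x \in L & s x != t x); last first.
    rewrite (AL s t) ?subrr ?normr0 ?addr0 => [|x xL].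
      by apply: ler_sum => x _; exact: le1.
    by apply: contrapT => xst; apply: H; exists x => //; exact/eqP.
  rewrite /S !(big_fsetD1 x xL) /= addrAC; apply: lerD; last by apply: ler_sum => y _; exact: le1.
  have := st x; move: xst; case: (s x); case: (t x) => // _; first by move/(_ isT).
  move=> _.
  by rewrite /=; case: (A s); case: (A t); rewrite /= ?subrr ?subr0 ?sub0r ?normrN ?normr1 ?normr0 ?add0r ?addr0 ?lexx ?ler01.
have main (F : config -> R) : (forall s, 0 <= F s) -> spin_increasing F ->
    gibbs beta (slab_over B) (fun=> false) F <= gibbs beta (slab_over B) (fun=> true) F.
  by move=> F0 Fi; apply: gibbs_mono.
have SE b : gibbs beta (slab_over B) (fun=> b) S = \sum_(x <- L) fv b B (up x).
  exact: gibbs_sum.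
have A01 s : 0 <= ((A s)%:R : R) <= 1 by case: (A s); rewrite ?lexx ?ler01.
have H1 : gibbs beta (slab_over B) (fun=> false) (fun s => S s + (A s)%:R) <=
          gibbs beta (slab_over B) (fun=> true) (fun s => S s + (A s)%:R).
  apply: main => [s|s t /Si]; first by rewrite addr_ge0.
  have := ler_norm ((A s)%:R - (A t)%:R : R); rewrite distrC; lra.
have H2 : gibbs beta (slab_over B) (fun=> false) (fun s => S s - (A s)%:R + 1) <=
          gibbs beta (slab_over B) (fun=> true) (fun s => S s - (A s)%:R + 1).
  apply: main => [s|s t /Si].
    by have := S0 s; have /andP[_] := A01 s; lra.
  have := ler_norm ((A t)%:R - (A s)%:R : R); lra.
have E b : gibbs beta (slab_over B) (fun=> b) (fun s => S s - (A s)%:R + 1) =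
    gibbs beta (slab_over B) (fun=> b) S - fv b B A + 1.
  by rewrite gibbsD gibbsB gibbs_cst.
rewrite !gibbsD !SE in H1; rewrite !E !SE in H2.
rewrite sumrB ler_norml; move: H1 H2; rewrite /fv.
set a := gibbs _ _ _ _; set b := \sum_(_ <- _) _; set c := gibbs _ _ _ _.
set d := \sum_(_ <- _) _.
by move: a b c d => a b c d; lra.
Qed.

(** Vanishing magnetization makes the bound of [fv_sign_diff] tend to 0, so the
two boundary conditions have the same limit. *)
Lemma fv_false_lim (A : event) : local_event A -> fv false B A @[B --> boxes] --> P A.
Proof.
move=> lA; have [L AL] := lA.
have C : (\sum_(x <- L) (fv true B (up x) - fv false B (up x))) @[B --> boxes] --> (0 : R).
  elim: (L : seq slab) => [|x r IH].
    by under eq_fun do rewrite big_nil; exact: cvg_cst.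
  have C1 : (1 : R) @[_ --> boxes] --> (1 : R) by exact: cvg_cst.
  have C0 : (fv true B (up x) - fv false B (up x)) @[B --> boxes] --> (0 : R).
    have -> : (fun B => fv true B (up x) - fv false B (up x)) =
        (fun B => 2 * fv true B (up x) - 1).
      by apply/funext => B; rewrite fv_up_false; ring.
    have : (2 * fv true B (up x) - 1) @[B --> boxes] --> 2 * P (up x) - 1.
      exact: (cvgB (@cvgMl_tmp _ _ _ boxes_filter _ 2 _ (P_lim (local_spin x))) C1).
    by rewrite spin_probE M0 subrr.
  under eq_fun do rewrite big_cons.
  by have := @cvgD _ _ _ _ boxes_filter _ _ _ _ C0 IH; rewrite addr0; apply.
have C2 : (fv true B A - \sum_(x <- L) (fv true B (up x) - fv false B (up x)))
    @[B --> boxes] --> P A.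
  by have := @cvgB _ _ _ _ boxes_filter _ _ _ _ (P_lim lA) C; rewrite subr0; apply.
have C3 : (fv true B A + \sum_(x <- L) (fv true B (up x) - fv false B (up x)))
    @[B --> boxes] --> P A.
  by have := @cvgD _ _ _ _ boxes_filter _ _ _ _ (P_lim lA) C; rewrite addr0; apply.
apply: (squeeze_cvgr _ C2 C3); apply: nearW => B.
by have := fv_sign_diff B AL; rewrite ler_norml; lra.
Qed.

Lemma P_neg (A : event) : local_event A -> P (fun s => A (negb \o s)) = P A.
Proof.
move=> lA; apply: (cvg_limit_unique (P_lim (local_neg lA))).
rewrite (_ : (fun B => _) = (fun B => fv false B A)); last by apply/funext => B; rewrite fv_neg.
exact: fv_false_lim.
Qed.

(** Whatever happens outside [B], the conditional probability of [A] is at least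
the one under minus boundary conditions. *)
Lemma P_mixing (B : {fset Z2}) (A G : event) : local_event A -> local_event G ->
  increasing_event A -> off (slab_over B) G ->
  fv false B A * P G <= P (fun s => G s && A s).
Proof.
move=> lA lG iA oG.
have C := @cvgMl_tmp _ _ _ boxes_filter _ (fv false B A) _ (P_lim lG).
apply: (cvg_le_limit C (P_lim (localI lG lA))).
have := near_boxes B; apply: filterS => B' BB'.
rewrite /fv; set q := gibbs beta (slab_over B) _ _; rewrite -gibbsZ.
have -> : gibbs beta (slab_over B') (fun=> true) (fun s => (G s && A s)%:R) =
    gibbs beta (slab_over B') (fun=> true) (fun s => (G s)%:R * (A s)%:R).
  by apply: eq_gibbs => s _; rewrite -mulnb natrM.
rewrite (@gibbs_tower _ _ (slab_over B) _ _ (fun s => (A s)%:R) (fun s => (G s)%:R)).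
- apply: ler_gibbs => s _; rewrite mulrC ler_wpM2l// /q.
  apply: gibbs_mono => //.
  by move=> t u /iA; case: (A t); case: (A u) => // /(_ isT).
- by apply/fsubsetP => x; rewrite !mem_slab_over => /(fsubsetP BB').
- by move=> s t st; rewrite (oG _ _ st).
Qed.

End vanishing_magnetization.
End magnetization_bounds.

(** * Arms around a square *)

Lemma conn_map (T T' : eqType) (e : rel T) (e' : rel T') (U : T -> bool)
    (U' : T' -> bool) (f : T -> T') x y :
  (forall a b, e a b -> e' (f a) (f b)) -> (forall z, U z -> U' (f z)) ->
  conn e U x y -> conn e' U' (f x) (f y).
Proof.
move=> fe fU xy; pattern y; apply: (conn_ind xy) => [Ux|a b _ IH ab Ub].
  exact/conn_refl/fU.
by apply: (conn_trans IH); apply: conn_adj; [exact: fe|exact: conn_endr IH|exact: fU].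
Qed.

Lemma conn_colw (U : Z2 -> bool) (x y1 y2 : int) :
  (forall y, (y1 <= y <= y2) || (y2 <= y <= y1) -> U (x, y)) ->
  conn adj_Z2 U (x, y1) (x, y2).
Proof.
move=> H; have [y12|/ltW y21] := lerP y1 y2.
  by apply: conn_col => // y yy; apply: H; rewrite yy.
apply: (conn_sym adj_Z2_sym); apply: conn_col => // y yy.
by apply: H; rewrite yy orbT.
Qed.

Lemma conn_roww (U : Z2 -> bool) (x1 x2 y : int) :
  (forall x, (x1 <= x <= x2) || (x2 <= x <= x1) -> U (x, y)) ->
  conn adj_Z2 U (x1, y) (x2, y).
Proof.
move=> H; have [x12|/ltW x21] := lerP x1 x2.
  by apply: conn_row => // x xx; apply: H; rewrite xx.
apply: (conn_sym adj_Z2_sym); apply: conn_row => // x xx.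
by apply: H; rewrite xx orbT.
Qed.

Definition sq (N : nat) : {fset Z2} :=
  let corner (q : 'I_(N + N).+1 * 'I_(N + N).+1) : Z2 := (q.1%:Z - N%:Z, q.2%:Z - N%:Z) in
  [fset corner q | q in {: 'I_(N + N).+1 * 'I_(N + N).+1}]%fset.

Lemma mem_sq N (c : Z2) :
  (c \in sq N) = (- N%:Z <= c.1 <= N%:Z) && (- N%:Z <= c.2 <= N%:Z).
Proof.
case: c => i j; apply/imfsetP/idP => [[[k l] _ [-> ->]]/=|/= ij].
  by have := ltn_ord k; have := ltn_ord l; lia.
have iN : (`|(i + N%:Z)%R| < (N + N).+1)%N by lia.
have jN : (`|(j + N%:Z)%R| < (N + N).+1)%N by lia.
by exists (Ordinal iN, Ordinal jN) => //=; congr pair; lia.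
Qed.

Lemma sq_box N : is_box (sq N).
Proof. by exists (- N%:Z), N%:Z, (- N%:Z), N%:Z => i j; rewrite mem_sq. Qed.

Lemma sub_sq (B : {fset Z2}) : exists n0, forall n, (n0 <= n)%N -> (B `<=` sq n)%fset.
Proof.
exists (\sum_(c <- B) (`|c.1| + `|c.2|))%N => n Bn; apply/fsubsetP => c cB.
rewrite mem_sq; have : (`|c.1| + `|c.2| <= n)%N.
  by apply: leq_trans Bn; rewrite (big_fsetD1 c)//= leq_addr.
by case: c {cB} => x y /=; lia.
Qed.

Lemma sq_sub m n : (m <= n)%N -> (sq m `<=` sq n)%fset.
Proof.
by move=> mn; apply/fsubsetP => -[x y]; rewrite !mem_sq /= => H; lia.
Qed.

Lemma bdry_sq N c : bdry (sq N) c ->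
  [\/ c.1 = N%:Z, c.1 = - N%:Z, c.2 = N%:Z | c.2 = - N%:Z].
Proof.
case: c => x y /andP[]; rewrite mem_sq /= => cN /asboolP[[x' y'] /adj_Z2P /= H].
rewrite mem_sq /= => nN.
have : x = N%:Z \/ x = - N%:Z \/ y = N%:Z \/ y = - N%:Z by case: H => H; lia.
by move=> [|[|[|]]]; [constructor 1|constructor 2|constructor 3|constructor 4].
Qed.

Lemma outside_conn N a b : a \notin sq N -> b \notin sq N ->
  conn adj_Z2 (fun z => z \notin sq N) a b.
Proof.
have top c : c \notin sq N -> conn adj_Z2 (fun z => z \notin sq N) c (N%:Z + 1, N%:Z + 1).
  case: c => x y; rewrite mem_sq /= => cN.
  have [yN|yN] := boolP (y < - N%:Z).
    apply: (@conn_trans _ _ _ _ (N%:Z + 1, y)).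
      by apply: conn_roww => x' _; rewrite mem_sq /=; lia.
    by apply: conn_colw => y' _; rewrite mem_sq /=; lia.
  apply: (@conn_trans _ _ _ _ (x, N%:Z + 1)).
    by apply: conn_colw => y' H; rewrite mem_sq /=; lia.
  by apply: conn_roww => x' _; rewrite mem_sq /=; lia.
by move=> aN bN; apply: conn_trans (top _ aN) (conn_sym adj_Z2_sym (top _ bN)).
Qed.

Lemma core_conn (n : int) v w : core n v -> core n w -> conn adj_Z2 (core n) v w.
Proof.
have mid c : core n c -> conn adj_Z2 (core n) c (0, 0).
  case: c => x y; rewrite /core /= => H.
  apply: (@conn_trans _ _ _ _ (0, y)).
    by apply: conn_roww => x' ?; rewrite /core /=; lia.
  by apply: conn_colw => y' ?; rewrite /core /=; lia.
by move=> /mid v0 /mid w0; exact: conn_trans v0 (conn_sym adj_Z2_sym w0).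
Qed.

(** ** The symmetries of the square *)

Definition sgnz (b : bool) (x : int) := if b then - x else x.

Definition dih (b : bool * bool * bool) (c : Z2) : Z2 :=
  let c' := if b.2 then (c.2, c.1) else c in (sgnz b.1.1 c'.1, sgnz b.1.2 c'.2).

Definition dihV (b : bool * bool * bool) (c : Z2) : Z2 :=
  let c' := (sgnz b.1.1 c.1, sgnz b.1.2 c.2) in if b.2 then (c'.2, c'.1) else c'.

Lemma dihK b : cancel (dih b) (dihV b).
Proof. by move: b => [[[] []] []] [x y]; rewrite /dih /dihV /= ?opprK. Qed.

Lemma dihVK b : cancel (dihV b) (dih b).
Proof. by move: b => [[[] []] []] [x y]; rewrite /dih /dihV /= ?opprK. Qed.

Lemma dist2_dih b c d : dist2 (dih b c) (dih b d) = dist2 c d.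
Proof. by move: b => [[[] []] []]; rewrite /dih /dist2 /=; ring. Qed.

Lemma adj_dih b c d : adj_Z2 (dih b c) (dih b d) = adj_Z2 c d.
Proof. by rewrite /adj_Z2 dist2_dih. Qed.

Lemma core_dih n b c : core n (dih b c) = core n c.
Proof.
by move: b c => [[[] []] []] [x y]; rewrite /dih /core /=; apply/idP/idP; lia.
Qed.

Lemma sq_dih N b c : (dih b c \in sq N) = (c \in sq N).
Proof. by move: b c => [[[] []] []] [x y]; rewrite !mem_sq /dih /=; lia. Qed.

Lemma bdry_dih N b c : bdry (sq N) (dih b c) = bdry (sq N) c.
Proof.
rewrite /bdry sq_dih; congr (_ && _); apply/asboolP/asboolP => -[e ce eN].
  by exists (dihV b e); rewrite -1?(sq_dih _ b) -1?(adj_dih b) dihVK.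
by exists (dih b e); rewrite ?sq_dih ?adj_dih.
Qed.

Lemma box_dih b (B : {fset Z2}) : is_box B -> is_box [fset dihV b c | c in B]%fset.
Proof.
have E i j : (i, j) \in [fset dihV b c | c in B]%fset = (dih b (i, j) \in B).
  apply/imfsetP/idP => [[c cB ->]|H]; first by rewrite dihVK.
  by exists (dih b (i, j)) => //; rewrite dihK.
move: b E => [[b1 b2] b3] E [a1 [a2 [c1 [c2 H]]]].
pose lo (b : bool) (u v : int) := if b then - v else u.
pose hi (b : bool) (u v : int) := if b then - u else v.
pose l1 := lo b1 a1 a2; pose h1 := hi b1 a1 a2.
pose l2 := lo b2 c1 c2; pose h2 := hi b2 c1 c2.
exists (if b3 then l2 else l1), (if b3 then h2 else h1),
  (if b3 then l1 else l2), (if b3 then h1 else h2) => i j.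
rewrite E /dih /= H /l1 /l2 /h1 /h2 /lo /hi.
by clear; case: b3; case: b1; case: b2; rewrite /=; lia.
Qed.

(** The corners are not in the square, so a step into it lands on an open side. *)
Lemma core_exit (n : int) a b : 0 < n -> adj_Z2 a b -> ~~ core n a -> core n b ->
  exists g y, 0 <= y < n /\ b = dih g (n, y).
Proof.
move: a b => [a1 a2] [x y] n0 /adj_Z2P /= H; rewrite /core /= => nA B.
have [[yn [E|E]]|[xn [E|E]]] : (- n < y < n /\ (x = n \/ x = - n)) \/
    (- n < x < n /\ (y = n \/ y = - n)).
  by clear -H nA B n0; case: H => -[? ?]; subst; lia.
- have [y0|y0] := lerP 0 y.
    by exists (false, false, false), y; rewrite /dih /= E; split=> //; lia.
  by exists (false, true, false), (- y); rewrite /dih /= E opprK; split=> //; lia.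
- have [y0|y0] := lerP 0 y.
    by exists (true, false, false), y; rewrite /dih /= E; split=> //; lia.
  by exists (true, true, false), (- y); rewrite /dih /= E opprK; split=> //; lia.
- have [y0|y0] := lerP 0 x.
    by exists (false, false, true), x; rewrite /dih /= E; split=> //; lia.
  by exists (true, false, true), (- x); rewrite /dih /= E opprK; split=> //; lia.
- have [y0|y0] := lerP 0 x.
    by exists (false, true, true), x; rewrite /dih /= E; split=> //; lia.
  by exists (true, true, true), (- x); rewrite /dih /= E opprK; split=> //; lia.
Qed.

(** [core_adjacent_sides] up to the reflections of the square. The heights may
not both be 0, since the point of height 0 on a side has only one neighbour
outside and the two connections are disjoint. *)
Lemma core_separation (m : Z2 -> Z2) (n : int) (U1 U2 : Z2 -> bool) f f' g g'
    (x y1 y2 y3 : int) :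
  involutive m -> (forall c d, adj_Z2 (m c) (m d) = adj_Z2 c d) ->
  (forall c, core n (m c) = core n c) ->
  2 <= n -> (forall z, U1 z -> ~~ core n z) -> (forall z, U2 z -> ~~ core n z) ->
  (forall z, U1 z -> U2 z -> False) ->
  - n < x < n -> - n < y2 <= 0 -> 0 <= y1 < n -> - n < y3 < n ->
  conn adj_Z2 U1 f f' -> conn adj_Z2 U2 g g' ->
  adj_Z2 f (m (n, y1)) -> adj_Z2 f' (m (x, - n)) ->
  adj_Z2 g (m (n, y2)) -> adj_Z2 g' (m (- n, y3)) -> False.
Proof.
move=> mK ma mc n2 U1D U2D U12 xn y2n y1n y3n ff' gg' fa f'a ga g'a.
have img (U : Z2 -> bool) c d : conn adj_Z2 U c d -> conn adj_Z2 (U \o m) (m c) (m d).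
  by apply: conn_map => [a b|z]; rewrite /= ?ma ?mK.
have y21 : y2 < y1.
  suff : ~ (y1 = 0 /\ y2 = 0) by clear -y2n y1n; lia.
  move=> [y10 y20]; rewrite y10 y20 in fa ga.
  have foot c : ~~ core n c -> adj_Z2 c (m (n, 0)) -> m c = (n + 1, 0).
    rewrite -mc -ma mK; case: (m c) => c1 c2 cD /adj_Z2P /= H.
    move: cD; rewrite /core /=; clear -n2 H => cD.
    by congr pair; case: H => -[? ?]; subst; lia.
  have E : f = g.
    rewrite -(mK f) -(mK g) (foot f) ?(foot g) //.
      exact/U2D/(conn_endl gg').
    exact/U1D/(conn_endl ff').
  by apply: (U12 f); [exact: conn_endl ff'|rewrite E; exact: conn_endl gg'].
apply: (@core_adjacent_sides n (U1 \o m) (U2 \o m) (m f) (m f') (m g) (m g') x y1 y2 y3).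
- by [].
- by move=> z /= /U1D; rewrite mc.
- by move=> z /= /U2D; rewrite mc.
- by move=> z /=; exact: U12.
- by [].
- by clear -y2n y21; lia.
- by clear -y1n; lia.
- by [].
- exact: img.
- exact: img.
- by rewrite -ma mK.
- by rewrite -ma mK.
- by rewrite -ma mK.
- by rewrite -ma mK.
Qed.

(** ** Six arms make a trifurcation *)

Definition annulus (n N : nat) (s : config) (z : Z2) : bool :=
  [&& z \in sq N, ~~ core n%:Z z & plus s z].

(** The eight half sides of the square are the images of the upper half of its
right side, so the arms of a given sign all have the same probability. *)
Definition arm (g : bool * bool * bool) (n N : nat) (s : config) : bool :=
  `[< exists y f w, [/\ 0 <= y < n%:Z, adj_Z2 f (dih g (n%:Z, y)), bdry (sq N) w &
        conn adj_Z2 (annulus n N s) f w] >].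

(** Three [++] arms from the upper right, the upper left and the bottom sides,
and three [--] arms from the lower right, the lower left and the top sides: any
two of the former are separated by two of the latter. *)
Definition six_arms (n N : nat) (s : config) : bool :=
  [&& arm (false, false, false) n N s, arm (true, false, false) n N s,
      arm (false, true, true) n N s, arm (false, true, false) n N (negb \o s),
      arm (true, true, false) n N (negb \o s) & arm (false, false, true) n N (negb \o s)].

(** Two [--] arms joined outside [sq N] form a barrier. It separates the two upper
[++] arms, for the arms from the lower right and the top; and each of them from
the [++] arm at the bottom, for the two lower arms. *)
Lemma six_arms_trifurcation (n N : nat) (s : config) (V : {fset Z2}) :
  (2 <= n)%N ->
  (forall c d, core n%:Z c -> adj_Z2 d c -> d \in V) ->
  (forall c, c \in V -> c \in sq N /\ ~~ bdry (sq N) c) ->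
  six_arms n N s -> (forall c, core n%:Z c -> plus s c) ->
  trifurcation adj_Z2 [fset c in V | plus s c]%fset [fset c in V | bdry V c]%fset
    [fset c in V | core n%:Z c]%fset.
Proof.
move=> n2 coreV Vsq /and5P[]; move=> /asboolP[yR [fR [wR [yRn fRa wRb cR]]]].
move=> /asboolP[yL [fL [wL [yLn fLa wLb cL]]]].
move=> /asboolP[yB [fB [wB [yBn fBa wBb cB]]]].
move=> /asboolP[zR [gR [vR [zRn gRa vRb dR]]]].
move=> /andP[/asboolP[zL [gL [vL [zLn gLa vLb dL]]]]].
move=> /asboolP[zT [gT [vT [zTn gTa vTb dT]]]] corep.
have nz2 : 2 <= n%:Z by clear -n2; lia.
have coreV' c : core n%:Z c -> c \in V.
  move=> cc; pose d : Z2 := (c.1 + 1, c.2).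
  have cd : adj_Z2 c d by rewrite [c]surjective_pairing adj_right.
  have [dc|dc] := boolP (core n%:Z d); first exact: coreV dc cd.
  pose d' : Z2 := (c.1 - 1, c.2).
  have cd' : adj_Z2 c d'.
    by rewrite adj_Z2_sym; have := adj_right (c.1 - 1) c.2; rewrite subrK -surjective_pairing.
  apply: coreV cd'; move: cc dc; rewrite /d /d' /core /=.
  by clear -nz2; case: c => c1 c2 /=; lia.
have mcore c : (c \in [fset c in V | core n%:Z c]%fset) = core n%:Z c.
  by rewrite !inE /=; apply: andb_idl; exact: coreV'.
have sideV g y f : 0 <= y < n%:Z -> adj_Z2 f (dih g (n%:Z, y)) ->
    core n%:Z (dih g (n%:Z, y)) /\ f \in V.
  move=> yn fa; have gc : core n%:Z (dih g (n%:Z, y)).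
    by rewrite core_dih /core /=; clear -nz2 yn; lia.
  by split=> //; exact: coreV gc fa.
have end_ g y f w : 0 <= y < n%:Z -> adj_Z2 f (dih g (n%:Z, y)) -> bdry (sq N) w ->
    conn adj_Z2 (annulus n N s) f w -> exists a,
    branch adj_Z2 [fset c in V | plus s c]%fset [fset c in V | bdry V c]%fset
      [fset c in V | core n%:Z c]%fset a /\ conn adj_Z2 (annulus n N s) f a.
  move=> yn fa wb fw; have [gc fV] := sideV _ _ _ yn fa.
  have wV : w \notin V by apply/negP => /Vsq[_]; rewrite wb.
  have [a [b [ca ab /and3P[bN _ bp] bV]]] := @conn_exit _ _ _ (mem V) _ _ fw fV wV.
  have /andP[/and3P[aN nac ap] aV] := conn_endr ca; rewrite /= in aV.
  exists a; split; last by apply: conn_sub ca => z /andP[].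
  split.
  - rewrite !inE /= aV /= /bdry aV; apply/asboolP; exists b => //.
  - by rewrite in_fsetD mcore nac !inE /= aV ap.
  - move=> v; rewrite mcore => vc.
    apply: (@conn_trans _ _ _ _ f).
      apply: (conn_sym adj_Z2_sym); apply: conn_sub ca => z /andP[/and3P[_ _ zp] zV].
      by rewrite !inE /= zp andbT.
    apply: (@conn_trans _ _ _ _ (dih g (n%:Z, y))).
      have /and3P[_ _ fp] := conn_endl fw.
      by apply: conn_adj => //; rewrite !inE /= ?fV ?fp// coreV'// corep.
    apply: conn_sub (core_conn gc vc) => z zc.
    by rewrite !inE /= coreV'// corep.
have [aR [bR caR]] := end_ _ _ _ _ yRn fRa wRb cR.
have [aL [bL caL]] := end_ _ _ _ _ yLn fLa wLb cL.
have [aB [bB caB]] := end_ _ _ _ _ yBn fBa wBb cB.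
have toann a b : fconn adj_Z2 ([fset c in V | plus s c] `\` [fset c in V | core n%:Z c])%fset a b ->
    conn adj_Z2 (annulus n N s) a b.
  apply: conn_sub => z; rewrite in_fsetD mcore !inE /= => /and3P[zc zV zp].
  by rewrite /annulus zc zp /= andbT; have [] := Vsq z zV.
have annS := conn_sym adj_Z2_sym.
pose Uo z := (z \notin sq N) || annulus n N (negb \o s) z.
have outer g g' v v' : bdry (sq N) v -> bdry (sq N) v' ->
    conn adj_Z2 (annulus n N (negb \o s)) g v ->
    conn adj_Z2 (annulus n N (negb \o s)) g' v' -> conn adj_Z2 Uo g g'.
  have half c u : bdry (sq N) u -> conn adj_Z2 (annulus n N (negb \o s)) c u ->
      exists2 t, t \notin sq N & conn adj_Z2 Uo c t.
    move=> /andP[_ /asboolP[t ut tN]] cu; exists t => //.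
    apply: (@conn_trans _ _ _ _ u); first by apply: conn_sub cu => z zz; rewrite /Uo zz orbT.
    by apply: conn_adj => //; rewrite /Uo ?tN// (conn_endr cu) orbT.
  move=> vb vb' gv gv'; have [t tN gt] := half _ _ vb gv; have [t' tN' gt'] := half _ _ vb' gv'.
  apply: (conn_trans gt); apply: (conn_trans _ (annS _ _ _ gt')).
  by apply: conn_sub (outside_conn tN tN') => z zN; rewrite /Uo zN.
have cN : (n < N)%N.
  pose c : Z2 := (n%:Z, 0); have cc : core n%:Z c by rewrite /core /=; clear -nz2; lia.
  have /Vsq[cN nb] : (n%:Z + 1, 0) \in V.
    by apply: coreV cc _; rewrite adj_Z2_sym adj_right.
  by move: cN; rewrite mem_sq /=; clear; lia.
have U1D z : annulus n N s z -> ~~ core n%:Z z by case/and3P.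
have U2D z : Uo z -> ~~ core n%:Z z.
  case/orP => [|/and3P[]//]; apply: contra; rewrite /core mem_sq => H.
  by clear -H cN; case: z H => z1 z2 /= H; lia.
have U12 z : annulus n N s z -> Uo z -> False.
  move=> /and3P[zN _ /andP[z0 _]] /orP[|/and3P[_ _ /andP[/=]]]; first by rewrite zN.
  by rewrite z0.
pose mx := dih (true, false, false); pose my := dih (false, true, false).
have mxK : involutive mx by move=> [x y]; rewrite /mx /dih /= opprK.
have myK : involutive my by move=> [x y]; rewrite /my /dih /= opprK.
have dLR : conn adj_Z2 Uo gR gL := outer _ _ _ _ vRb vLb dR dL.
have sepRB : ~ conn adj_Z2 (annulus n N s) fR fB.
  move=> RB; apply: (@core_separation id n%:Z _ _ _ _ _ _ yB yR (- zR) (- zL) _ _ _ nz2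
    U1D U2D U12 _ _ yRn _ RB dLR) => //; clear -yBn zRn zLn; lia.
have sepLB : ~ conn adj_Z2 (annulus n N s) fL fB.
  move=> LB; apply: (@core_separation mx n%:Z _ _ _ _ _ _ (- yB) yL (- zL) (- zR) mxK
    (adj_dih _) (core_dih _ _) nz2 U1D U2D U12 _ _ yLn _ LB (annS _ _ _ dLR)).
  - by clear -yBn; lia.
  - by clear -zLn; lia.
  - by clear -zRn; lia.
  - exact: fLa.
  - by move: fBa; rewrite /mx /dih /= opprK.
  - exact: gLa.
  - by move: gRa; rewrite /mx /dih /= opprK.
have sepRL : ~ conn adj_Z2 (annulus n N s) fR fL.
  move=> RL; apply: (@core_separation my n%:Z _ _ _ _ _ _ zT zR (- yR) (- yL) myK
    (adj_dih _) (core_dih _ _) nz2 U2D U1D _ _ _ zRn _ (outer _ _ _ _ vRb vTb dR dT) RL).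
  - by move=> z Uz az; exact: U12 az Uz.
  - by clear -zTn; lia.
  - by clear -yRn; lia.
  - by clear -yLn; lia.
  - exact: gRa.
  - by move: gTa; rewrite /my /dih /= opprK.
  - by move: fRa; rewrite /my /dih /= opprK.
  - by move: fLa; rewrite /my /dih /= opprK.
have sep f f' a a' : conn adj_Z2 (annulus n N s) f a -> conn adj_Z2 (annulus n N s) f' a' ->
    ~ conn adj_Z2 (annulus n N s) f f' ->
    ~ fconn adj_Z2 ([fset c in V | plus s c] `\` [fset c in V | core n%:Z c])%fset a a'.
  move=> fa fa' nff /toann aa'; apply: nff; apply: (conn_trans fa).
  exact: conn_trans aa' (annS _ _ _ fa').
have sepS a a' : ~ fconn adj_Z2 ([fset c in V | plus s c] `\` [fset c in V | core n%:Z c])%fset a a' ->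
    ~ fconn adj_Z2 ([fset c in V | plus s c] `\` [fset c in V | core n%:Z c])%fset a' a.
  by move=> H H'; apply: H; exact: annS.
have hRB := sep _ _ _ _ caR caB sepRB; have hLB := sep _ _ _ _ caL caB sepLB.
have hRL := sep _ _ _ _ caR caL sepRL.
exists (fun i : 'I_3 => if i == 0 :> nat then aR else if i == 1%N :> nat then aL else aB).
split => [[[|[|[|//]]] ?]|[[|[|[|//]]] ?] [[|[|[|//]]] ?]] //= _; by [|apply: sepS].
Qed.

(** * A grid of tiles *)

Lemma trifurcation_map (T : choiceType) (e : rel T) (f g : T -> T)
    (U U' Y Y' t t' : {fset T}) : cancel f g -> cancel g f ->
  (forall a b, e (f a) (f b) = e a b) ->
  (forall c, (f c \in U') = (c \in U)) -> (forall c, (f c \in Y') = (c \in Y)) ->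
  (forall c, (f c \in t') = (c \in t)) ->
  trifurcation e U Y t -> trifurcation e U' Y' t'.
Proof.
move=> fK gK fe fU fY ft [a [bra sep]]; exists (f \o a); split=> [i|i j ij H].
  have [aY aU at_] := bra i; split=> [|| v vt'] /=; first by rewrite fY.
    by move: aU; rewrite !in_fsetD ft fU.
  rewrite -(gK v); apply: conn_map (at_ (g v) _); last by rewrite -ft gK.
    by move=> b c; rewrite fe.
  by move=> z; rewrite fU.
apply: (sep i j ij); rewrite -(fK (a i)) -(fK (a j)); apply: conn_map H => [b c|z].
  by rewrite -{1}(gK b) -{1}(gK c) fe.
by rewrite -{1}(gK z) !in_fsetD ft fU.
Qed.

Definition core_sites (n : nat) : seq slab := slab_over [fset c in sq n | core n%:Z c]%fset.

Definition good_tile (n N : nat) (s : config) : bool :=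
  six_arms n N s && all s (core_sites n).

Lemma core_sitesP n s : reflect (forall c, core n%:Z c -> plus s c) (all s (core_sites n)).
Proof.
have coreE c : (c \in [fset c in sq n | core n%:Z c]%fset) = core n%:Z c.
  by rewrite !inE /=; apply: andb_idl; rewrite mem_sq => /and3P[-> ->].
apply: (iffP allP) => [H c cc|H [c i]].
  by rewrite /plus !H// /core_sites mem_slab_over coreE.
rewrite mem_slab_over coreE /= => /H /andP[].
by case: (I2P i) => ->.
Qed.

Section grid.
Variables (n K : nat).
Hypothesis n2 : (2 <= n)%N.

(** Squares of radius [n] with centers at this distance are disjoint. *)
Definition spacing : nat := (n + n).+1.
Definition grid : seq ('I_K * 'I_K) := enum {: 'I_K * 'I_K}.
Definition center (q : 'I_K * 'I_K) : Z2 :=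
  ((spacing * q.1)%:Z, (spacing * q.2)%:Z).
(** The grid fits into [sq radius] with a margin of one spacing. *)
Definition radius : nat := (spacing * K.+1)%N.
Definition tile (q : 'I_K * 'I_K) : {fset Z2} :=
  [fset c in sq radius | core n%:Z (c.1 - (center q).1, c.2 - (center q).2)]%fset.

Lemma spacing_inj (i j : 'I_K) : (- (n + n)%:Z <= (spacing * i)%:Z - (spacing * j)%:Z <= (n + n)%:Z) -> i = j.
Proof. by rewrite /spacing => H; apply: val_inj => /=; nia. Qed.

Lemma center_bounds (q : 'I_K * 'I_K) :
  [/\ 0 <= (center q).1, (center q).1 + spacing%:Z <= radius%:Z, 0 <= (center q).2 &
      (center q).2 + spacing%:Z <= radius%:Z].
Proof.
rewrite /center /radius /=; have := ltn_ord q.1; have := ltn_ord q.2.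
by move=> H1 H2; split; nia.
Qed.

Lemma tileE q (c : Z2) : (c \in tile q) = core n%:Z (c.1 - (center q).1, c.2 - (center q).2).
Proof.
rewrite /tile; move: (center q) (center_bounds q) => [x y] [/= z1 z1' z2 z2'].
rewrite !inE /=; apply: andb_idl; rewrite mem_sq /core /spacing /= in z1' z2' *.
by clear -z1 z1' z2 z2'; case: c => c1 c2 /=; lia.
Qed.

Lemma tile_disjoint q q' c : c \in tile q -> c \in tile q' -> q = q'.
Proof.
rewrite !tileE /center /core /= => H H'.
rewrite [q]surjective_pairing [q']surjective_pairing.
by congr pair; apply: spacing_inj; clear -H H'; lia.
Qed.

Lemma tile_center q : center q \in tile q.
Proof. by rewrite tileE !subrr /core /=; clear -n2; lia. Qed.

Lemma good_tile_trifurcation q s : good_tile n (radius + radius).+1 (shift (center q) s) ->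
  trifurcation adj_Z2 [fset c in sq radius | plus s c]%fset
    [fset c in sq radius | bdry (sq radius) c]%fset (tile q).
Proof.
move=> /andP[arms /core_sitesP cp].
set z := center q; pose f (c : Z2) : Z2 := (c.1 + z.1, c.2 + z.2).
pose g (c : Z2) : Z2 := (c.1 - z.1, c.2 - z.2).
have fK : cancel f g by move=> [x y]; rewrite /f /g /= !addrK.
have gK : cancel g f by move=> [x y]; rewrite /f /g /= !subrK.
have fe a b : adj_Z2 (f a) (f b) = adj_Z2 a b.
  by rewrite /adj_Z2 /dist2 /f /=; congr (_ ^+ 2 + _ ^+ 2 == _); ring.
pose V := [fset g c | c in sq radius]%fset.
have memV c : (c \in V) = (f c \in sq radius).
  apply/imfsetP/idP => [[d dV ->]|fcV]; first by rewrite gK.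
  by exists (f c) => //; rewrite fK.
have [z1 z1' z2 z2'] := center_bounds q; rewrite -/z /spacing in z1 z1' z2 z2'.
have tri : trifurcation adj_Z2 [fset c in V | plus (shift z s) c]%fset
    [fset c in V | bdry V c]%fset [fset c in V | core n%:Z c]%fset.
  apply: (six_arms_trifurcation n2 _ _ arms cp).
    move=> [c1 c2] [d1 d2] cc /adj_Z2P dc; rewrite memV mem_sq /f.
    move: cc dc; rewrite /core; move: z z1 z1' z2 z2' {f g fK gK fe V memV cp arms}.
    by clear => -[x y] /= z1 z1' z2 z2' cc [] [? ?]; lia.
  move=> [c1 c2]; rewrite memV mem_sq /f => H; split.
    rewrite mem_sq; move: z z1 z1' z2 z2' H {f g fK gK fe V memV cp arms}.
    by clear => -[x y] /= z1 z1' z2 z2' H; lia.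
  apply/negP => /bdry_sq; move: z z1 z1' z2 z2' H {f g fK gK fe V memV cp arms}.
  by clear => -[x y] /= z1 z1' z2 z2' H [] B; lia.
apply: (@trifurcation_map _ _ f g _ _ _ _ _ _ fK gK fe _ _ _ tri).
- by move=> c; rewrite !inE /= memV.
- move=> c; rewrite !inE /= memV; congr (_ && _).
  rewrite /bdry memV; congr (_ && _); apply/asboolP/asboolP => -[e ce eV].
    by exists (g e); rewrite ?memV -1?fe gK.
  by exists (f e); rewrite -?memV ?fe.
- by move=> c; rewrite !inE /= memV /f /= -/z !addrK -surjective_pairing.
Qed.

Lemma card_bdry_sq N : (#|` [fset c in sq N | bdry (sq N) c]%fset| <= 4 * (N + N).+1)%N.
Proof.
pose l (f : int -> Z2) := [seq f (i%:Z - N%:Z) | i <- iota 0 (N + N).+1].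
pose ls := l (fun i => (N%:Z, i)) ++ l (fun i => (- N%:Z, i)) ++
           l (fun i => (i, N%:Z)) ++ l (fun i => (i, - N%:Z)).
have -> : (4 * (N + N).+1)%N = size ls.
  by rewrite !size_cat !size_map !size_iota; lia.
apply: uniq_leq_size; first exact: fset_uniq.
move=> c cY; have [cN cb] : c \in sq N /\ bdry (sq N) c.
  by move: cY; rewrite !inE => /andP[].
move: c cb cN {cY} => [x y] /bdry_sq /= B; rewrite mem_sq /= => xyN.
have inl (f : int -> Z2) (i : int) : - N%:Z <= i <= N%:Z -> f i \in l f.
  move=> iN; apply/mapP; exists `|(i + N%:Z)%R|%N; first by rewrite mem_iota; lia.
  by congr f; lia.
rewrite !mem_cat; case: B => E; rewrite ?E.
- by apply/orP; left; apply: (inl (fun i => (N%:Z, i))); clear -xyN; lia.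
- by apply/or4P; constructor 2; apply: (inl (fun i => (- N%:Z, i))); clear -xyN; lia.
- by apply/or4P; constructor 3; apply: (inl (fun i => (i, N%:Z))); clear -xyN; lia.
- by apply/or4P; constructor 4; apply: (inl (fun i => (i, - N%:Z))); clear -xyN; lia.
Qed.

Lemma count_good_tiles s :
  (count (fun q => good_tile n (radius + radius).+1 (shift (center q) s)) grid
    <= 4 * (radius + radius).+1)%N.
Proof.
set good := fun q => _; pose ts := [seq tile q | q <- grid & good q].
have -> : count good grid = size ts by rewrite size_map size_filter.
have inj : injective tile.
  move=> q q' E; apply: (@tile_disjoint _ _ (center q)); first exact: tile_center.
  by rewrite -E tile_center.
have tsP t : t \in ts -> exists2 q, good q & t = tile q.
  by move=> /mapP[q]; rewrite mem_filter => /andP[gq _] ->; exists q.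
apply: leq_trans (card_bdry_sq radius); apply: leq_trans (fsubset_leq_card (fsubsetIl _ _)).
apply: (@size_trifurcations _ _ adj_Z2_sym _ [fset c in sq radius | plus s c]%fset).
- by rewrite map_inj_uniq//; apply: filter_uniq; exact: enum_uniq.
- move=> t /tsP[q gq ->]; split; first by apply/fset0Pn; exists (center q); exact: tile_center.
  apply/fsubsetP => c cq; rewrite !inE /=; apply/andP; split.
    by move: cq; rewrite !inE => /andP[].
  move: gq => /andP[_ /core_sitesP H]; move: cq; rewrite tileE => /H.
  by rewrite /plus /shift /= /column_map /= !subrK -surjective_pairing.
- move=> t v w /tsP[q gq ->]; rewrite !tileE => vq wq.
  have H := core_conn vq wq.
  pose f (c : Z2) : Z2 := (c.1 + (center q).1, c.2 + (center q).2).
  have fE c : c = f (c.1 - (center q).1, c.2 - (center q).2).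
    by case: c => x y; rewrite /f /= !subrK.
  rewrite (fE v) (fE w); apply: conn_map H => [a b|c cc].
    by rewrite /adj_Z2 /dist2 /f /= => /eqP <-; apply/eqP; congr (_ ^+ 2 + _ ^+ 2); ring.
  by rewrite tileE /f /= !addrK -surjective_pairing.
- move=> t t' /tsP[q gq ->] /tsP[q' gq' ->] tt'; apply/fdisjointP => c cq.
  by apply: contra tt' => cq'; rewrite (tile_disjoint cq cq').
- by move=> t /tsP[q gq ->]; exact: good_tile_trifurcation.
Qed.

End grid.

(** * No percolation without magnetization *)

Lemma arm_ext g n N s t :
  (forall z, z \in sq N -> ~~ core n%:Z z -> plus s z = plus t z) ->
  arm g n N s = arm g n N t.
Proof.
move=> st; have E z : annulus n N s z = annulus n N t z.
  rewrite /annulus; have [zN|//] := boolP (z \in sq N).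
  by have [//|zc] := boolP (core _ _); rewrite /= st.
congr asbool; apply/propext; split => -[y [f [w [yn fa wb fw]]]]; exists y, f, w;
  by split=> //; apply: conn_sub fw => z; rewrite E.
Qed.

Lemma arm_local g n N : local_event (arm g n N).
Proof.
exists (slab_over (sq N)) => s t st; apply: arm_ext => z zN _.
by rewrite /plus !st ?mem_slab_over.
Qed.

Lemma arm_increasing g n N : increasing_event (arm g n N).
Proof.
move=> s t st /asboolP[y [f [w [yn fa wb fw]]]]; apply/asboolP; exists y, f, w.
split=> //; apply: conn_sub fw => z /and3P[zN zc /andP[/st z0 /st z1]].
by rewrite /annulus zN zc /plus z0.
Qed.

Lemma arm_off g n N (L : {fset slab}) :
  (forall x, x \in L -> core n%:Z x.1) -> off L (arm g n N).
Proof.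
move=> Lc s t st; apply: arm_ext => z _ zc.
by rewrite /plus !st//; apply/negP => /Lc; rewrite (negbTE zc).
Qed.

Lemma arm_dih g n N s :
  arm g n N s = arm (false, false, false) n N (s \o column_map (dih g)).
Proof.
have E z : annulus n N s (dih g z) = annulus n N (s \o column_map (dih g)) z.
  by rewrite /annulus sq_dih core_dih.
apply/asboolP/asboolP => -[y [f [w [yn fa wb fw]]]].
  exists y, (dihV g f), (dihV g w); split => //.
  - by rewrite -(adj_dih g) dihVK; move: fa; rewrite {2}/dih /=.
  - by rewrite -(bdry_dih _ g) dihVK.
  - apply: conn_map fw => [a b|z]; first by rewrite -(adj_dih g (dihV g a)) !dihVK.
    by rewrite -E dihVK.
exists y, (dih g f), (dih g w); split => //.
- by rewrite adj_dih; move: fa; rewrite {1}/dih /=.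
- by rewrite bdry_dih.
- by apply: conn_map fw => [a b|z]; rewrite ?adj_dih// E.
Qed.

Definition all_dih : seq (bool * bool * bool) := enum {: bool * bool * bool}.

(** The arm starts where the escape leaves the square for the last time. *)
Lemma escapes_has_arm n N s : (2 <= n < N)%N -> escapes (sq N) s origin ->
  has (fun g => arm g n N s) all_dih.
Proof.
move=> /andP[n2 nN] /asboolP[d db od].
have co := conn_sym adj_Z2_sym od.
have oc : core n%:Z origin by rewrite /core /=; lia.
have dc : ~~ core n%:Z d.
  by have := bdry_sq db; case: d {od co db} => x y /=; rewrite /core /= => -[]; lia.
have [|a [b [da ab /andP[bN bp] bc]]] :=
    @conn_exit _ _ _ (fun z => ~~ core n%:Z z) _ _ co dc; first by rewrite negbK.
rewrite negbK in bc.
have /andP[/andP[aN ap] /= ac] := conn_endr da.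
have n0 : 0 < n%:Z by lia.
have [g [y [yn bE]]] := core_exit n0 ab ac bc.
apply/hasP; exists g; first by rewrite mem_enum.
apply/asboolP; exists y, a, d; split=> //; first by rewrite -bE.
apply: (conn_sym adj_Z2_sym); apply: conn_sub da => z /andP[/andP[zN zp] zc].
by rewrite /annulus zN zc.
Qed.

Lemma core_sites_core n x : x \in core_sites n -> core n%:Z x.1.
Proof. by rewrite /core_sites mem_slab_over !inE /= => /andP[]. Qed.

Local Notation esc N := (fun s => escapes (sq N) s origin).

Lemma esc_local N : local_event (esc N).
Proof. by exists (slab_over (sq N)); exact: escapes_local. Qed.

Lemma origin_sq N : origin \in sq N.
Proof. by rewrite mem_sq /=; lia. Qed.

Lemma esc_le m n s : (m <= n)%N -> escapes (sq n) s origin -> escapes (sq m) s origin.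
Proof. by move=> mn; apply: escapes_sub (origin_sq m); exact: sq_sub. Qed.

Lemma has_arm_local n N : local_event (fun s => has (fun g => arm g n N s) all_dih).
Proof. by apply: local_has => g; exact: arm_local. Qed.

Lemma six_arms_local n N : local_event (six_arms n N).
Proof.
have lA g := arm_local g n N; have lN g := local_neg (lA g).
exact: (localI (lA _) (localI (lA _) (localI (lA _)
  (localI (lN _) (localI (lN _) (lN _)))))).
Qed.

Lemma good_tile_local n N : local_event (good_tile n N).
Proof.
apply: localI; first exact: six_arms_local.
by apply: (local_all (core_sites n) (A := fun x s => s x)); exact: local_spin.
Qed.

Section no_percolation.
Context {R : realType}.
Variable beta : R.
Hypothesis beta_ge0 : 0 <= beta.
Variable P : event -> R.
Hypothesis P_lim : forall A, local_event A -> fv beta true B A @[B --> boxes] --> P A.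
Hypothesis M0 : 2 * spin_prob P = 1.

Local Notation fv := (fv beta).

(** By mixing, the absence of an arm from a large square decouples from the escape
of the origin to a moderate distance, which has probability at least [theta]; yet
the two are nearly incompatible, so the absence is unlikely. *)
Lemma has_arm_whp (theta : R) : 0 < theta -> (forall N, theta <= P (esc N)) ->
  forall eps : R, 0 < eps -> exists2 n, (2 <= n)%N & forall N, (n < N)%N ->
    1 - P (fun s => has (fun g => arm g n N s) all_dih) <= eps.
Proof.
move=> th0 thP eps e0.
pose delta := eps * theta / 2; have d0 : 0 < delta by rewrite !mulr_gt0 ?invr_gt0.
have [m mP] : exists m, forall N, P (esc m) - P (esc N) <= delta.
  pose S := [set P (esc N) | N in [set: nat]].
  have hS : has_inf S.
    split; first by exists (P (esc 0%N)), 0%N.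
    by exists 0 => _ [N _ <-]; by apply: (P_ge0 P_lim); exact: esc_local.
  have [_ [m _ <-] Hm] := inf_adherent d0 hS.
  exists m => N; have : inf S <= P (esc N) by apply: inf_lbound; [exact: hS.2|exists N].
  lra.
have /cvgrPdist_lt/(_ (theta / 2)) := fv_false_lim beta_ge0 P_lim M0 (esc_local m).
case=> [|B0 _ HB]; first by rewrite divr_gt0.
have [n0 Hn0] := sub_sq B0.
(* The mixing radius is n.-1, because sq n.-1 is contained in core n. *)
pose n := (maxn n0 m).+2; exists n => // N nN.
have n1 : (n0 <= n.-1)%N by rewrite /n /=; have := leq_maxl n0 m; lia.
have mN : (m <= N)%N by have := leq_maxr n0 m; rewrite /n in nN *; lia.
have close : theta / 2 <= fv false (sq n.-1) (esc m).
  have /= := HB _ (conj (sq_box n.-1) (Hn0 _ n1)).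
  by rewrite ltr_distl => /andP[_ +]; have := thP m; lra.
pose G (s : config) := ~~ has (fun g => arm g n N s) all_dih.
have lG : local_event G := localC (has_arm_local n N).
rewrite -(P_C P_lim (has_arm_local n N)) -/G.
have mix := P_mixing beta_ge0 P_lim (B := sq n.-1) (esc_local m) lG.
have : fv false (sq n.-1) (esc m) * P G <= P (fun s => G s && escapes (sq m) s origin).
  apply: mix; first exact: escapes_increasing.
  move=> s t st; congr (~~ _); apply: eq_has => g.
  apply: (@arm_off _ _ _ (slab_over (sq n.-1))) => // x.
  by rewrite mem_slab_over mem_sq /core; case: x => [[x y] i] /=; rewrite /n; lia.
have : P (fun s => G s && escapes (sq m) s origin) <= delta.
  apply: le_trans (mP N); rewrite (P_split P_lim (esc_local m) (esc_local N)).
  rewrite (@eq_P _ P (fun s => escapes (sq m) s origin && escapes (sq N) s origin) (esc N));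
    last first.
    by move=> s; apply: andb_idl; exact: esc_le.
  rewrite addrAC subrr add0r; apply: (le_P P_lim).
  - by apply: localI => //; exact: esc_local.
  - by apply: localI; [exact: esc_local|apply: localC; exact: esc_local].
  - move=> s /andP[Gs ->] /=; apply: contra Gs; apply: escapes_has_arm.
    by rewrite nN.
have PG0 : 0 <= P G by exact: (P_ge0 P_lim).
move=> H1 H2; have : theta / 2 * P G <= delta.
  apply: le_trans (le_trans H2 H1); exact: ler_wpM2r.
rewrite /delta; have -> : eps * theta / 2 = theta / 2 * eps by field.
by rewrite ler_pM2l// divr_gt0.
Qed.

(** Square-root trick: by symmetry the eight arms are equally likely, and by FKG
the eighth power of the probability that a given one is absent is at most the
probability that all are. *)
Lemma arm_whp (theta : R) : 0 < theta -> (forall N, theta <= P (esc N)) ->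
  exists2 n, (2 <= n)%N & forall g N, (n < N)%N -> 1 - P (arm g n N) <= 100^-1.
Proof.
move=> th0 thP.
have [|n n2 H] := has_arm_whp th0 thP (eps := 100^-1 ^+ 8); first by rewrite exprn_gt0.
exists n => // g N nN; apply: le_trans (_ : 1 - P (arm (false, false, false) n N) <= _).
  rewrite (eq_P P (arm_dih g n N)) (P_sym P_lim (@dihK g) (@dihVK g)) ?lexx//.
  - exact: dist2_dih.
  - exact: box_dih.
  - exact: arm_local.
have := P_fkg_none beta_ge0 P_lim all_dih (fun g => arm_local g n N)
  (fun g => arm_increasing (g := g) (n := n) (N := N)).
move=> /le_trans/(_ (H N nN)).
have -> : \prod_(i <- all_dih) (1 - P (arm i n N)) =
    (1 - P (arm (false, false, false) n N)) ^+ 8.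
  rewrite (eq_bigr (fun=> 1 - P (arm (false, false, false) n N))) => [|i _].
    by rewrite big_const_seq count_predT -cardE !card_prod !card_bool iter_mulr_1.
  rewrite (eq_P P (arm_dih i n N)) (P_sym P_lim (@dihK i) (@dihVK i))//.
  - exact: dist2_dih.
  - exact: box_dih.
  - exact: arm_local.
rewrite ler_pXn2r ?nnegrE// subr_ge0 -[1](P_cst P_lim true).
by apply: (le_P P_lim) => //; [exact: arm_local|exact: local_cst].
Qed.

(** Union bound over the six arms; those of sign [--] are as likely as the others
since [P] is invariant under the flip. *)
Lemma six_arms_whp (theta : R) : 0 < theta -> (forall N, theta <= P (esc N)) ->
  exists2 n, (2 <= n)%N & forall N, (n < N)%N -> 2^-1 <= P (six_arms n N).
Proof.
move=> th0 thP; have [n n2 H] := arm_whp th0 thP; exists n => // N nN.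
pose A (i : nat) : event := nth (fun=> true)
  [:: arm (false, false, false) n N; arm (true, false, false) n N;
      arm (false, true, true) n N; (fun s => arm (false, true, false) n N (negb \o s));
      (fun s => arm (true, true, false) n N (negb \o s));
      (fun s => arm (false, false, true) n N (negb \o s))] i.
have lA i : local_event (A i).
  by move: i => [|[|[|[|[|[|i]]]]]]; rewrite /A /= ?nth_nil; do ?apply: local_neg;
    try exact: arm_local; exact: local_cst.
have PA i : 1 - P (A i) <= 100^-1.
  move: i => [|[|[|[|[|[|i]]]]]]; rewrite /A /= ?nth_nil ?(P_cst P_lim true);
    try exact: H; try (by rewrite (P_neg beta_ge0 P_lim M0 (arm_local _ _ _)); exact: H).
  by rewrite subrr invr_ge0.
have := P_union P_lim (iota 0 6) (fun i => localC (lA i)).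
have -> : P (fun s => has (fun i => ~~ A i s) (iota 0 6)) = 1 - P (six_arms n N).
  rewrite -(P_C P_lim (six_arms_local n N)); apply: eq_P => s.
  by rewrite /= /A /= orbF /six_arms !negb_and.
have : \sum_(i <- iota 0 6) P (fun s => ~~ A i s) <= \sum_(i <- iota 0 6) 100^-1.
  by apply: ler_sum => i _; rewrite (P_C P_lim).
rewrite big_const_seq count_predT size_iota iter_addr addr0 => h1 h2.
have := le_trans h2 h1; rewrite -mulr_natr; lra.
Qed.

(** The arms do not depend on the spins in the square, so finite energy fills it at
a price that does not depend on [N]. *)
Lemma good_tile_pos (theta : R) : 0 < theta -> (forall N, theta <= P (esc N)) ->
  exists n (kappa : R), [/\ (2 <= n)%N, 0 < kappa &
    forall N, (n < N)%N -> kappa <= P (good_tile n N)].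
Proof.
move=> th0 thP; have [n n2 H] := six_arms_whp th0 thP.
have [|c c0 Hc] := P_force beta_ge0 P_lim (r := core_sites n); first exact: fset_uniq.
exists n, (c * 2^-1); split=> // [|N nN]; first by rewrite mulr_gt0.
apply: le_trans (_ : c * P (six_arms n N) <= _); first by rewrite ler_pM2l// H.
apply: Hc; first exact: six_arms_local.
have offs g : off [fset x in core_sites n]%fset (arm g n N).
  by apply: arm_off => x; rewrite inE; exact: core_sites_core.
move=> s t st; have nst : agree_off [fset x in core_sites n]%fset (negb \o s) (negb \o t).
  by move=> x xL /=; rewrite st.
by rewrite /six_arms !(offs _ _ _ st) !(offs _ _ _ nst).
Qed.

(** The expected number of disjoint trifurcations grows like the area, whereas
their number is at most the perimeter. *)
Lemma esc_vanish (theta : R) : 0 < theta -> exists N, P (esc N) < theta.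
Proof.
move=> th0; apply: contrapT => /forallNP nP.
have thP N : theta <= P (esc N) by rewrite leNgt; apply/negP; exact: nP.
have [n [kappa [n2 k0 kP]]] := good_tile_pos th0 thP.
pose C : R := (16 * spacing n)%:R.
(* K is so large that kappa * K ^+ 2 exceeds the perimeter bound C * (K + 1). *)
pose K := (Num.bound (C / kappa)).*2.+1.
have CK : 2 * C < K%:R * kappa.
  have : C / kappa < (Num.bound (C / kappa))%:R.
    by apply: archi_boundP; rewrite divr_ge0 ?ler0n// ltW.
  rewrite ltr_pdivrMr// => h.
  have -> : K%:R = 2 * (Num.bound (C / kappa))%:R + 1 :> R.
    by rewrite /K -natr1 -mul2n natrM.
  by lra.
set N := (radius n K + radius n K).+1.
have nN : (n < N)%N by rewrite /N /radius /spacing; nia.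
have : \sum_(q <- grid K) P (fun s => good_tile n N (shift (center n q) s)) <=
    (4 * N)%:R.
  apply: (P_sum_le P_lim) => [q _|s].
    exact: shift_local (good_tile_local n N).
  rewrite -natr_sum ler_nat; apply: leq_trans (count_good_tiles K n2 s).
  rewrite -sum1_count [leqRHS]big_mkcond /=; apply: eq_leq; apply: eq_bigr => q _.
  by rewrite /N; case: good_tile.
have : \sum_(q <- grid K) kappa <= 
   \sum_(q <- grid K) P (fun s => good_tile n N (shift (center n q) s)).
  apply: ler_sum => q _; rewrite (P_shift P_lim); first exact: kP.
  exact: good_tile_local.
rewrite big_const_seq count_predT -cardE card_prod card_ord iter_addr addr0.
move=> H1 H2; have := le_trans H1 H2.
have : (4 * N <= 16 * spacing n * K.+1)%N.
  by rewrite /N /radius; have : (0 < spacing n)%N by []; nia.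
rewrite -(ler_nat R) => H3 /le_trans/(_ H3).
have -> : (16 * spacing n * K.+1)%:R = C * (K%:R + 1) :> R by rewrite natrM natr1.
have -> : kappa *+ (K * K) = (K%:R * kappa) * K%:R by rewrite -[LHS]mulr_natr natrM; ring.
have K1 : 1 <= K%:R :> R by rewrite ler1n.
have C0 : 0 <= C by exact: ler0n.
clearbody C K N; clear -CK K1 C0; move: (K%:R : R) CK K1 => k CK k1 H; nra.
Qed.

End no_percolation.

(** * From the weak limit to probabilities of local events *)

(** Lists the range of [ssum], to compare it with the restrictions in
[{ffun L -> bool}] over which the finite-volume measures sum. *)
Fixpoint refills (l : seq slab) (sigma : config) : seq config :=
  if l is x :: l' then refills l' (upd sigma x true) ++ refills l' (upd sigma x false)
  else [:: sigma].

Lemma ssum_refills (R : realFieldType) l (F : config -> R) sigma :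
  ssum l F sigma = \sum_(c <- refills l sigma) F c.
Proof.
elim: l sigma => [|x l IH] sigma /=; first by rewrite big_seq1.
by rewrite big_cat /= -!IH.
Qed.

Lemma mem_refills l sigma c : reflect (agree_off l sigma c) (c \in refills l sigma).
Proof.
elim: l sigma => [|x l IH] sigma /=.
  rewrite inE; apply: (iffP eqP) => [-> //|H]; apply/funext => y; exact: H.
rewrite mem_cat; apply: (iffP orP) => [[] /IH/agree_off_upd//|H].
have [cx|cx] := boolP (c x); [left|right]; apply/IH => y yl; rewrite /upd;
  case: eqVneq => [->|yx]; rewrite ?cx ?(negbTE cx)//; apply: H;
  by rewrite inE negb_or yx.
Qed.

Lemma uniq_refills l sigma : uniq l -> uniq (refills l sigma).
Proof.
elim: l sigma => [//|x l IH] sigma /= /andP[xl ul].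
rewrite cat_uniq !IH ?andbT//; apply/hasPn => c /mem_refills/(_ x xl) c0.
apply/negP => /mem_refills/(_ x xl); rewrite c0 /upd eqxx.
by [].
Qed.

Lemma sum_extend (R : realFieldType) (s : bool) (L : {fset slab}) (F : config -> R) :
  \sum_(tau : {ffun L -> bool}) F (extend s tau) = ssum L F (fun=> s).
Proof.
rewrite ssum_refills -(big_map (@extend s L : {ffun L -> bool} -> config) xpredT F).
apply: perm_big; apply: uniq_perm.
- rewrite map_inj_uniq ?index_enum_uniq// => t1 t2 /(congr1 (fun c : config => c)) E.
  apply/ffunP => x; have := congr1 (fun c : config => c (val x)) E.
  by rewrite /extend valK.
- exact/uniq_refills/fset_uniq.
move=> c; apply/mapP/mem_refills => [[tau _ -> x xL]|H].
  by rewrite /extend insubF//; exact: negbTE.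
exists [ffun x : L => c (val x)]; first exact: mem_index_enum.
apply/funext => x; rewrite /extend; case: insubP => [u _ <- /=|xL]; first by rewrite ffunE.
by rewrite /= H.
Qed.

Lemma measurable_local (A : event) : local_event A -> measurable [set s : Sigma2 | A s].
Proof.
have cyl x b : measurable [set s : Sigma2 | s x = b].
  apply: sub_sigma_algebra; exists [fset x]%fset, (fun=> b).
  apply/seteqP; split => s /= H => [y|]; first by rewrite inE => /eqP ->.
  by apply: H; rewrite inE.
suff H (l : seq slab) (B : event) :
    (forall s t : config, (forall x, x \in l -> s x = t x) -> B s = B t) ->
    measurable [set s : Sigma2 | B s] by move=> [L AL]; exact: (H L).
elim: l B => [|x l IH] B BL.
  have [Bt|Bt] := boolP (B (fun=> true)).
    rewrite (_ : [set _ | _] = setT); first exact: measurableT.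
    by apply/seteqP; split => s //= _; rewrite (BL s (fun=> true)).
  rewrite (_ : [set _ | _] = set0); first exact: measurable0.
  by apply/seteqP; split => s //=; rewrite (BL s (fun=> true))// (negbTE Bt).
have -> : [set s : Sigma2 | B s] =
    ([set s : Sigma2 | s x = true] `&` [set s : Sigma2 | B (upd s x true)]) `|`
    ([set s : Sigma2 | s x = false] `&` [set s : Sigma2 | B (upd s x false)]).
  have updE (s : config) : upd s x (s x) = s.
    by apply/funext => y; rewrite /upd; case: eqVneq => // ->.
  apply/seteqP; split => s /=.
    by case E: (s x) => Bs; [left|right]; split=> //; rewrite -E updE.
  by move=> [] [E]; rewrite -E updE.
have BU b : measurable [set s : Sigma2 | B (upd s x b)].
  apply: IH => s t st; apply: BL => y; rewrite inE /upd; case: eqVneq => //= _.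
  exact: st.
by apply: measurableU; apply: measurableI.
Qed.

(** A local function is locally constant in the product topology. *)
Lemma continuous_local (R : realType) (A : event) : local_event A ->
  continuous ((fun s => (A s)%:R) : prod_topology (fun _ : slab => bool) -> R).
Proof.
move=> [L AL] s; apply: cvg_near_cst.
have : nbhs s (\bigcap_(x in [set` L])
    [set t : prod_topology (fun _ : slab => bool) | t x = s x]).
  apply: filter_bigI => x _.
  have := @proj_continuous slab (fun=> bool) x s [set b | b = s x].
  by apply; rewrite nbhs_principalE.
apply: filterS => t H /=; congr (_%:R); congr nat_of_bool; apply: AL => x xL.
exact: H.
Qed.

Section weak_limit.
Variables (R : realType) (beta : R) (s : bool) (mu : probability Sigma2 R).
Hypothesis muP : is_ising_limit beta s mu.

(** Flips all spins in the case of minus boundary conditions, which reduces it to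
plus boundary conditions. *)
Definition orient (sigma : config) : config := if s then sigma else negb \o sigma.

Definition oriented_set (A : event) : set Sigma2 := [set sigma | A (orient sigma)].

Definition limit_prob (A : event) : R := fine (mu (oriented_set A)).

Lemma orient_local A : local_event A -> local_event (fun sigma => A (orient sigma)).
Proof.
by move=> lA; rewrite /orient; case: s => //; exact: local_neg.
Qed.

Lemma measurable_oriented A : local_event A -> measurable (oriented_set A).
Proof. by move=> lA; exact: measurable_local (orient_local lA). Qed.

Lemma ising_fv (B : {fset Z2}) A :
  ising beta s (slab_over B) (oriented_set A) = (fv beta true B A)%:E.
Proof.
have -> : fv beta true B A =
    gibbs beta (slab_over B) (fun=> s) (fun sigma => (A (orient sigma))%:R).
  rewrite /fv /orient; case: s => //.
  by rewrite (gibbs_neg beta (slab_over B) (fun=> false) (fun s => (A s)%:R)).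
rewrite /ising /gibbs -!sum_extend mulr_suml -sumEFin; apply: eq_bigr => tau _.
rewrite diracE -EFinM mulrAC; congr (_ %:E); congr (_ * _ / _); congr (_%:R).
by congr nat_of_bool; apply/idP/idP; rewrite inE.
Qed.

Lemma mu_limit_prob A : local_event A -> mu (oriented_set A) = (limit_prob A)%:E.
Proof.
by move=> lA; rewrite /limit_prob fineK// fin_num_measure//; exact: measurable_oriented.
Qed.

Lemma limit_prob_cvg A : local_event A ->
  fv beta true B A @[B --> boxes] --> limit_prob A.
Proof.
move=> lA; have mA := measurable_oriented lA.
pose f (sigma : Sigma2) : R := (A (orient sigma))%:R.
have fint (nu : probability Sigma2 R) :
    (\int[nu]_sigma (f sigma)%:E)%E = nu (oriented_set A).
  rewrite -[X in nu X]setIT -integral_indic//; apply: eq_integral => sigma _.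
  by rewrite /f indicE; congr (_%:R%:E); congr nat_of_bool; apply/idP/idP; rewrite inE.
have bf : exists M : R, forall sigma, `|f sigma| <= M.
  by exists 1 => sigma; rewrite /f; case: (A _); rewrite ?normr1 ?normr0.
have := muP (continuous_local (orient_local lA)) bf.
rewrite fint mu_limit_prob// => H.
have {}H : ((fv beta true B A)%:E @[B --> boxes] --> (limit_prob A)%:E)%E.
  move: H; rewrite (_ : (fun B => _) = (fun B => (fv beta true B A)%:E)) //.
  by apply/funext => B; rewrite fint; exact: ising_fv.
exact: (fine_cvg H).
Qed.

(** ** Percolation *)

Lemma signed_columnsE sigma c : signed_columns s sigma c <-> plus (orient sigma) c.
Proof.
rewrite /signed_columns /= /column_sum /orient /plus.
by case: s => /=; case: (sigma _); case: (sigma _).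
Qed.

Lemma bdry_exit (N : nat) C : connected_Z2 C -> C origin -> infinite_set C ->
  exists d p, [/\ path adj_Z2 origin p, last origin p = d, d \notin sq N &
    forall e, e \in p -> C e].
Proof.
move=> conC C0 infC.
have [d Cd dN] : exists2 d, C d & d \notin sq N.
  apply: contrapT => H; apply: infC; apply: (@sub_finite_set _ _ [set` sq N]).
    move=> d Cd /=; apply: contrapT => dN; apply: H; exists d => //; exact/negP.
  exact: finite_fset.
by have [p [ep lp Cp]] := conC _ _ C0 Cd; exists d, p.
Qed.

(** A connected set is infinite if and only if it leaves every square; the maximal
one is the set of all columns connected to the origin. *)
Lemma infinite_clusterE : [set sigma : Sigma2 | exists C : set Z2,
    [/\ is_cluster s sigma C, C origin & infinite_set C]] =
  \bigcap_N oriented_set (fun sigma => escapes (sq N) sigma origin).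
Proof.
apply/seteqP; split=> sigma.
  move=> [C [[Cs conC _] C0 infC]] N _ /=.
  have [d [p [ep lp dN Cp]]] := bdry_exit N conC C0 infC.
  have od : conn adj_Z2 (plus (orient sigma)) origin d.
    exists p; split=> //; apply/allP => e; rewrite inE => /predU1P[->|/Cp/Cs/signed_columnsE//].
    exact/signed_columnsE/Cs.
  have [|a [b [oa ab bp bN]]] := @conn_exit _ _ _ (fun z => z \in sq N) _ _ od _ dN.
    by rewrite mem_sq /=; lia.
  apply/asboolP; exists a.
    have /andP[_ aN] := conn_endr oa; rewrite /= in aN.
    by rewrite /bdry aN; apply/asboolP; exists b.
  by apply: conn_sub oa => z /andP[/= zp zN]; rewrite zN zp.
move=> H; pose U := plus (orient sigma).
exists [set c | conn adj_Z2 U origin c]; split.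
- split.
  + by move=> c /conn_endr/signed_columnsE.
  + move=> c d /= oc od.
    have [p [cp lp Up]] := conn_trans (conn_sym adj_Z2_sym oc) od.
    exists p; split=> // e ep; apply: (conn_trans oc); move: cp Up.
    case/splitPr: ep {lp} => p1 p2; rewrite -cat_rcons cat_path -cat_cons all_cat.
    move=> /andP[cp1 _] /andP[Up1 _]; exists (rcons p1 e); split=> //.
    by rewrite last_rcons.
  + move=> D CD Ds conD; apply/seteqP; split=> // d Dd /=.
    have [] := conD origin d _ Dd.
      by apply: CD => /=; apply: conn_refl; exact: escapes_plus (H 0%N I).
    move=> p [ep lp Dp]; exists p; split=> //; apply/allP => e.
    rewrite inE => /predU1P[->|/Dp/Ds/signed_columnsE//].
    exact: escapes_plus (H 0%N I).
- by apply: conn_refl; exact: escapes_plus (H 0%N I).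
- move=> finC.
  have [n0 Hn] := sub_sq (fset_set [set c | conn adj_Z2 U origin c]).
  have /asboolP[d db od] := H n0.+1 I.
  have : d \in sq n0.
    apply: (fsubsetP (Hn n0 (leqnn _))); rewrite in_fset_set// inE /=.
    by apply: conn_sub od => z /andP[].
  by rewrite mem_sq; have := bdry_sq db; case: d {db od} => x y /= -[]; lia.
Qed.

Lemma percolationE : percolation s mu =
  mu (\bigcap_N oriented_set (fun sigma => escapes (sq N) sigma origin)).
Proof. by rewrite /percolation infinite_clusterE. Qed.

Lemma percolation_le N : (percolation s mu <=
  (limit_prob (fun sigma => escapes (sq N) sigma origin))%:E)%E.
Proof.
rewrite percolationE -mu_limit_prob; last exact: esc_local.
apply: le_measure; rewrite ?inE; last by move=> sigma /(_ N I).
  by apply: bigcapT_measurable => m; apply: measurable_oriented; exact: esc_local.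
by apply: measurable_oriented; exact: esc_local.
Qed.

Lemma percolation_ge (x : R) :
  (forall N, x <= limit_prob (fun sigma => escapes (sq N) sigma origin)) ->
  (x%:E <= percolation s mu)%E.
Proof.
move=> H; rewrite percolationE.
pose F N := oriented_set (fun sigma => escapes (sq N) sigma origin).
have mF N : measurable (F N) by apply: measurable_oriented; exact: esc_local.
have C : (mu \o F) N @[N --> \oo] --> mu (\bigcap_N F N).
  apply: nonincreasing_cvg_mu => //.
  - by rewrite -ge0_fin_numE// fin_num_measure.
  - exact: bigcapT_measurable.
  - by move=> m n mn; apply/subsetPset => sigma; exact: esc_le.
have <- := cvg_lim (@ereal_hausdorff R) C.
apply: lime_ge; first by apply: cvgP C.
apply: nearW => N /=.
by rewrite mu_limit_prob ?lee_fin//; exact: esc_local.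
Qed.

Lemma magnetizationE : `|magnetization mu|%E = (`|2 * spin_prob limit_prob - 1|)%:E.
Proof.
pose p := spin_prob limit_prob.
pose A : set Sigma2 := oriented_set (up (origin, ord0)).
have mA : measurable A by apply: measurable_oriented; exact: local_spin.
have muA : mu A = p%:E by apply: mu_limit_prob; exact: local_spin.
have muA' : mu (~` A) = (1 - p)%:E by rewrite probability_setC// muA.
pose sg : R := if s then 1 else -1.
have E (sigma : Sigma2) : spin (sigma (origin, ord0)) = sg * (\1_A sigma - \1_(~` A) sigma).
  rewrite !indicE in_setC; have -> : (sigma \in A) = up (origin, ord0) (orient sigma).
    by apply/idP/idP; rewrite inE.
  by rewrite /spin /sg /up /orient; case: s => /=; case: (sigma _) => /=; ring.
rewrite /magnetization unlock.
have -> : (\int[mu]_w (spin (w (origin, ord0)))%:E)%E = (sg * (p - (1 - p)))%:E.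
  have mA' := measurableC mA.
  have i1 := integrable_indic mu mA; have i2 := integrable_indic mu mA'.
  under eq_integral do rewrite E EFinM EFinB.
  rewrite integralZl//; last exact: integrableB.
  rewrite integralB_EFin// !integral_indic// !setIT.
  transitivity (sg%:E * (p%:E - (1 - p)%:E))%E => //.
  by congr (_ * (_ - _))%E.
rewrite /= -/p normrM (_ : `|sg| = 1) ?mul1r; last by rewrite /sg; case: s; rewrite ?normrN normr1.
by congr (_%:E); congr `|_|; ring.
Qed.

End weak_limit.

Theorem theorem5p1 (R : realType) (beta : R) (beta_ge0 : 0 <= beta) (s : bool)
    (mu : probability Sigma2 R) (muP : is_ising_limit beta s mu) :
  (`|magnetization mu| <= percolation s mu)%E /\
  ((0 < percolation s mu)%E <-> (0 < `|magnetization mu|)%E).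
Proof.
have P_lim := limit_prob_cvg muP.
pose m := 2 * spin_prob (limit_prob s mu) - 1.
have m0 : 0 <= m by have := spin_prob_ge beta_ge0 P_lim; rewrite /m; lra.
have M : `|magnetization mu|%E = m%:E by rewrite (magnetizationE s) ger0_norm.
have mR : (m%:E <= percolation s mu)%E.
  apply: percolation_ge => N; apply: (spin_prob_le_escapes beta_ge0 P_lim).
  exact: origin_sq.
rewrite M; split=> //; split=> [R0|]; last by move=> /lt_le_trans; apply.
rewrite lte_fin lt_def m0 andbT; apply/eqP => m00.
have M0 : 2 * spin_prob (limit_prob s mu) = 1 by move: m00; rewrite /m; lra.
have [r r0 rR] : exists2 r : R, 0 < r & (r%:E <= percolation s mu)%E.
  have := percolation_le s mu 0; move: R0; case: (percolation s mu) => [r|//|//].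
  by rewrite lte_fin => r0 _; exists r.
have [N HN] := esc_vanish beta_ge0 P_lim M0 r0.
have := le_trans rR (percolation_le s mu N); rewrite lee_fin leNgt.
by rewrite HN.
Qed.
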